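(* Let $\mathcal{X}\subseteq\mathbb{R}^{n_1}$ and $\Sigma\subseteq\mathbb{R}^{n_2}$ be open. Let $b_i(x,\sigma):=\int_{\mathcal{X}} a_i(y)\,\mathrm{d}\delta_{x,\sigma}(y)$, $i=1,\dots,m$, be $C^r$-functions on $\mathcal{X}\times\Sigma$ with $r>\mathcal{N}^M_{\mathsf{A}}\,(n_1+n_2+1)-m$. Then \[\left\lceil\frac{m}{n_1+n_2+1}\right\rceil\ \leq\ \mathcal{N}^M_{\mathsf{A}}\ \leq\ \mathcal{C}^M_{\mathsf{A}}.\]
   Context: Setting. $\Sigma$ is a set of parameters (contained in a larger metric space, here $\mathbb{R}^{n_2}$), and for every $(\xi,\sigma)\in\mathcal{X}\times\Sigma$ a probability measure $\delta_{\xi,\sigma}$ on $\mathcal{X}$ is given. $\mathsf{A}=\{a_1,\dots,a_m\}$ is a set of $m$ linearly independent continuous functions $a_i:\mathcal{X}\to\mathbb{R}$ with $\left|\int_{\mathcal{X}} a_i\,\mathrm{d}\delta_{\xi,\sigma}\right|<\infty$ for all $(\xi,\sigma)\in\mathcal{X}\times\Sigma$. There is $\sigma_0\in\overline{\Sigma}$ such that $\lim_{\Sigma\ni\sigma\to\sigma_0}\int_{\mathcal{X}} a_i\,\mathrm{d}\delta_{\xi,\sigma}=a_i(\xi)$ for all $\xi\in\mathcal{X}$ and $i=1,\dots,m$. Notation. $t_{\mathsf{A}}(x,\sigma):=\left(\int_{\mathcal{X}} a_i\,\mathrm{d}\delta_{x,\sigma}\right)_{i=1}^m\in\mathbb{R}^m$.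 For $k\in\mathbb{N}$, $T_{k,\mathsf{A}}:\mathbb{R}_{\geq0}^k\times\mathcal{X}^k\times\Sigma^k\to\mathbb{R}^m$, $T_{k,\mathsf{A}}(C,X,\bar\sigma):=\sum_{i=1}^k c_i\,t_{\mathsf{A}}(x_i,\sigma_i)$ with $C=(c_i)_i$, $X=(x_i)_i$, $\bar\sigma=(\sigma_i)_i$. $\mathcal{T}_{\mathsf{A}}:=\mathrm{range}\,T_{m,\mathsf{A}}$. $\mathcal{N}^M_{\mathsf{A}}:=\min\{k\in\mathbb{N}\mid DT_{k,\mathsf{A}}\text{ has full rank}\}$, where $DT_{k,\mathsf{A}}$ is the total derivative of $T_{k,\mathsf{A}}$ with respect to all variables $c_i$, $x_i$, $\sigma_i$, and ''has full rank'' means that it has rank $m$ at some point $(C,X,\bar\sigma)$. For $s\in\mathcal{T}_{\mathsf{A}}$, $\mathcal{C}^M_{\mathsf{A}}(s)$ is the smallest $k$ such that $s=\sum_{i=1}^k c_i\,t_{\mathsf{A}}(x_i,\sigma_i)$ for some $c_i>0$, $(x_i,\sigma_i)\in\mathcal{X}\times\Sigma$. $\mathcal{C}^M_{\mathsf{A}}:=\max_{s\in\mathcal{T}_{\mathsf{A}}}\mathcal{C}^M_{\mathsf{A}}(s)$. *)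

(* Defs.v *)
From HB Require Import structures.
From mathcomp Require Import all_boot all_order all_algebra.
From mathcomp Require Import all_classical all_reals all_analysis.

Set Implicit Arguments.
Unset Strict Implicit.
Unset Printing Implicit Defensive.

Import Order.TTheory GRing.Theory Num.Theory.
Import numFieldNormedType.Exports.

Local Open Scope classical_set_scope.
Local Open Scope ring_scope.

(* Least (resp. greatest) element of a set of naturals; the value is 0 when
   there is none. *)
Definition nat_min (P : set nat) : nat :=
  xget 0%N [set k | P k /\ forall j, P j -> (k <= j)%N].

Definition nat_max (P : set nat) : nat :=
  xget 0%N [set k | P k /\ forall j, P j -> (j <= k)%N].

(* f is of class C^r on the open set U.  Only the germs of f at the points of U
   matter.  V is meant to be finite-dimensional: continuity (and, recursively,
   C^r regularity) of x |-> 'd f x as a map into the linear operators is then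
   the same as that of x |-> 'd f x v for every v. *)
Fixpoint class_C (R : realType) (V W : normedModType R) (r : nat)
    (U : set V) (f : V -> W) {struct r} : Prop :=
  if r is r'.+1 then
    (forall x, U x -> differentiable f x) /\
    (forall v, class_C r' U (fun x => 'd f x v))
  else forall x, U x -> {for x, continuous f}.

Notation borel_rV R n := (g_sigma_algebraType (@open 'rV[R]_n)).

Definition lin_indep_on (R : realType) (T : Type) (m : nat)
    (X : set T) (a : 'I_m -> T -> R) : Prop :=
  forall l : 'I_m -> R,
    (forall x, X x -> \sum_(i < m) l i * a i x = 0) -> forall i, l i = 0.

(* A probability measure on X is encoded as a Borel probability measure on R^n1
   giving mass 1 to X; delta x s is only relevant for x in X and s in the
   parameter set. *)
Definition moment (R : realType) (n1 n2 m : nat) (X : set 'rV[R]_n1)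
    (a : 'I_m -> 'rV[R]_n1 -> R)
    (delta : 'rV[R]_n1 -> 'rV[R]_n2 -> probability (borel_rV R n1) R)
    (i : 'I_m) (x : 'rV[R]_n1) (s : 'rV[R]_n2) : R :=
  \int[delta x s]_(y in X) a i y.

Definition moment_vec (R : realType) (n1 n2 m : nat) (X : set 'rV[R]_n1)
    (a : 'I_m -> 'rV[R]_n1 -> R)
    (delta : 'rV[R]_n1 -> 'rV[R]_n2 -> probability (borel_rV R n1) R)
    (x : 'rV[R]_n1) (s : 'rV[R]_n2) : 'rV[R]_m :=
  \row_i moment X a delta i x s.

(* The variables ((C, X), sigma) of T_k; the i-th rows of the two matrices are
   x_i and sigma_i. *)
Notation params R n1 n2 k := ('rV[R]_k * 'M[R]_(k, n1) * 'M[R]_(k, n2))%type.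

Definition T_dom (R : realType) (n1 n2 : nat) (X : set 'rV[R]_n1)
    (S : set 'rV[R]_n2) (k : nat) : set (params R n1 n2 k) :=
  [set p : params R n1 n2 k | forall i : 'I_k,
     [/\ 0 <= p.1.1 0 i, X (row i p.1.2) & S (row i p.2)]].

(* T_k is given by its formula on the whole ambient vector space, so that its
   total derivative makes sense at every point of T_dom, including those where
   some c_i is 0. *)
Definition T_map (R : realType) (n1 n2 m : nat)
    (t : 'rV[R]_n1 -> 'rV[R]_n2 -> 'rV[R]_m) (k : nat)
    (p : params R n1 n2 k) : 'rV[R]_m :=
  \sum_(i < k) p.1.1 0 i *: t (row i p.1.2) (row i p.2).

Definition DT_full_rank (R : realType) (n1 n2 m : nat) (X : set 'rV[R]_n1)
    (S : set 'rV[R]_n2) (t : 'rV[R]_n1 -> 'rV[R]_n2 -> 'rV[R]_m)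
    (k : nat) : Prop :=
  exists p : params R n1 n2 k,
    [/\ T_dom X S p, differentiable (T_map t (k := k)) p &
        \dim (limg (linfun ('d (T_map t (k := k)) p))) = m].

Definition N_M (R : realType) (n1 n2 m : nat) (X : set 'rV[R]_n1)
    (S : set 'rV[R]_n2) (t : 'rV[R]_n1 -> 'rV[R]_n2 -> 'rV[R]_m) : nat :=
  nat_min [set k | DT_full_rank X S t k].

Definition moment_cone (R : realType) (n1 n2 m : nat) (X : set 'rV[R]_n1)
    (S : set 'rV[R]_n2) (t : 'rV[R]_n1 -> 'rV[R]_n2 -> 'rV[R]_m) :
    set 'rV[R]_m :=
  T_map t (k := m) @` @T_dom R n1 n2 X S m.

(* k = 0 (the empty sum) is admitted, so that the value at s = 0
   is 0. *)
Definition C_M_at (R : realType) (n1 n2 m : nat) (X : set 'rV[R]_n1)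
    (S : set 'rV[R]_n2) (t : 'rV[R]_n1 -> 'rV[R]_n2 -> 'rV[R]_m)
    (s : 'rV[R]_m) : nat :=
  nat_min [set k | exists (c : 'I_k -> R) (x : 'I_k -> 'rV[R]_n1)
                          (sigma : 'I_k -> 'rV[R]_n2),
    (forall i, [/\ 0 < c i, X (x i) & S (sigma i)]) /\
    s = \sum_(i < k) c i *: t (x i) (sigma i)].

Definition C_M (R : realType) (n1 n2 m : nat) (X : set 'rV[R]_n1)
    (S : set 'rV[R]_n2) (t : 'rV[R]_n1 -> 'rV[R]_n2 -> 'rV[R]_m) : nat :=
  nat_max (C_M_at X S t @` moment_cone X S t).

(* Main.v *)
Require Import Defs.
From HB Require Import structures.
From mathcomp Require Import all_boot all_order all_algebra.
From mathcomp Require Import ring lra zify.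
From mathcomp Require Import all_classical all_reals all_analysis.

Set Implicit Arguments.
Unset Strict Implicit.
Unset Printing Implicit Defensive.

Import Order.TTheory GRing.Theory Num.Theory.
Import numFieldNormedType.Exports.

Local Open Scope classical_set_scope.
Local Open Scope ring_scope.

(* If [k] is the maximal number of atoms needed for a point of the moment cone, then
   the cone is covered by the images of finitely many maps [T_j], [j <= k], restricted
   to positive weights.  If [k < N_M], all these maps have rank [< m] everywhere, so by
   Sard's theorem their images are small, whereas the cone has nonempty interior.

   Measure zero is replaced by Baire category: images of compact sets with empty
   interior.  Slicing a compact set with nonempty interior by a hyperplane gives a set
   with nonempty interior in the hyperplane, which plays the role of Fubini's theorem.
   Sard's theorem for [C^r] maps with finite [r] goes through Morse's lemma: a set on
   which [C^k] functions vanish is a countable union of pieces of lower-dimensional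
   [C^1] graphs along which these functions are [O(|u - x|^k)].  On such pieces, the
   image is too thin to contain a box, by counting cells of two grids.

   That [N_M] is attained, and at most [m], is seen at points with zero weights: there
   continuity of [t] suffices for [T_m] to be differentiable, and the weights alone span. *)

(** * Differentials and the classes C^r *)

(** The count of derivatives: [sard_thin] asks for class C^(r+1) with n + 1 <= r + [#|S|], one
    derivative more than the sharp form of Sard's theorem, because the grid argument works with O(|u
    - x|^r) and has to win strictly. The bound on r in the theorem is stated at [N_M], while Sard's
    theorem is applied to T_k with k < [N_M], whose source has at least n1 + n2 + 1 >= 1 fewer
    dimensions; this pays for the extra derivative. Slicing by a level of [phi i] lowers the
    dimensions of source and target by one each, so the inequality and the class are both preserved.
    The family [phi] stays fixed and only the index set [S] shrinks, so the target is never
    reindexed. Empty interior passes to countable unions only for closed sets. Hence every piece is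
    kept compact: a nonzero derivative is replaced by one of absolute value at least 1/(p+1), and
    open domains by compact exhaustions. The lower bound is a mere count of variables, once the
    minimum defining [N_M] is known to be attained. *)

Section Differentials.
Variables (R : realType) (V W : normedModType R).

Lemma diff_eps (f : V -> W) x : differentiable f x ->
  forall e, 0 < e -> \forall h \near (0 : V),
    `|f (h + x) - f x - 'd f x h| <= e * `|h|.
Proof.
move=> df e e0; have /eqaddoP H := diff_locally df.
have := H _ e0; apply: filterS => h /=; by rewrite !fctE /= opprD addrA.
Qed.

Lemma diff_of_eps (f : V -> W) (df : {linear V -> W}) x : continuous df ->
  (forall e, 0 < e -> \forall h \near (0 : V),
    `|f (h + x) - f x - df h| <= e * `|h|) ->
  differentiable f x /\ 'd f x = df :> (V -> W).
Proof.
move=> dfc H.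
have E : f \o shift x = cst (f x) + df +o_ (0 : V) id.
  apply/eqaddoP => e e0; have := H _ e0; apply: filterS => h /=.
  by rewrite !fctE /= opprD addrA.
have D := diff_unique dfc E; split=> //.
by apply/diff_locallyP; rewrite D.
Qed.

Lemma diff_near_eq (f g : V -> W) x : (\forall y \near x, f y = g y) ->
  differentiable f x -> differentiable g x /\ 'd g x = 'd f x :> (V -> W).
Proof.
move=> fg df; apply: diff_of_eps; first exact: diff_continuous.
move=> e e0; have := diff_eps df e0.
have : \forall h \near (0 : V), f (h + x) = g (h + x).
  by move: fg; rewrite (near_shift 0) /=; apply: filterS => h; rewrite subr0.
apply: filterS2 => h ->; by rewrite (nbhs_singleton fg).
Qed.

End Differentials.

Section MulInv.
Variables (R : realType) (V : normedModType R).
Implicit Types f g : V -> R^o.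

Lemma diff_mul f g x : differentiable f x -> differentiable g x ->
  differentiable (fun y => f y * g y : R^o) x /\
  forall v, 'd (fun y => f y * g y : R^o) x v = f x * 'd g x v + g x * 'd f x v.
Proof.
move=> df dg; split; first exact: differentiableM df dg.
by move=> v; have /(congr1 (fun h => h v)) := diffM df dg.
Qed.

Lemma diff_inv f x : differentiable f x -> f x != 0 ->
  differentiable (fun y => (f y)^-1 : R^o) x /\
  forall v, 'd (fun y => (f y)^-1 : R^o) x v = - ((f x)^-1 * (f x)^-1) * 'd f x v.
Proof.
move=> df f0; split; first exact: differentiableV df f0.
move=> v; have /(congr1 (fun h => h v)) := diffV df f0.
by move=> E; rewrite -invfM; exact: E.
Qed.
End MulInv.

Section ClassC.
Variables (R : realType).
Implicit Types V W : normedModType R.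

Lemma class_C_sub V W r (U U' : set V) (f : V -> W) :
  U' `<=` U -> class_C r U f -> class_C r U' f.
Proof.
move=> UU; elim: r f => [|r IH] f /=; first by move=> H x /UU /H.
by move=> [H1 H2]; split=> [x /UU /H1|v] //; exact: IH.
Qed.

(** On an open set, equality of the functions is equality of germs, so it passes to the
    differentials and the induction goes on. *)
Lemma class_C_ext V W r (U : set V) (f g : V -> W) : open U ->
  (forall x, U x -> f x = g x) -> class_C r U f -> class_C r U g.
Proof.
move=> oU; elim: r f g => [|r IH] f g fg /= H.
  move=> x Ux; have nU : nbhs x U by exact: open_nbhs_nbhs.
  have := H _ Ux; rewrite /prop_for /continuous_at -(fg _ Ux).
  by apply: cvg_trans; apply: near_eq_cvg; apply: filterS nU => y /fg.
case: H => H1 H2.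
have D x : U x -> differentiable g x /\ 'd g x = 'd f x :> (V -> W).
  move=> Ux; apply: diff_near_eq (H1 _ Ux).
  have nU : nbhs x U by exact: open_nbhs_nbhs.
  exact: filterS nU.
split=> [x /D[]//|v]; apply: IH (H2 v) => x Ux.
exact: (esym (congr1 (fun h : V -> W => h v) (D _ Ux).2)).
Qed.

Lemma class_CW V W r (U : set V) (f : V -> W) :
  class_C r.+1 U f -> class_C r U f.
Proof.
elim: r f => [|r IH] f [H1 H2].
  by move=> x /H1; exact: differentiable_continuous.
by split=> // v; exact: IH.
Qed.

Lemma class_C_le V W r s (U : set V) (f : V -> W) : (s <= r)%N ->
  class_C r U f -> class_C s U f.
Proof.
move=> /subnK <-; elim: (r - s)%N => // k IH.
by rewrite addSn => /class_CW.
Qed.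

Lemma class_C_continuous V W r (U : set V) (f : V -> W) x :
  class_C r U f -> U x -> {for x, continuous f}.
Proof. by move=> /(@class_C_le _ _ _ 0%N _ _ (leq0n r)); exact. Qed.

Lemma class_C_cst V W r (U : set V) (c : W) : class_C r U (fun=> c).
Proof.
elim: r c => [|r IH] c /=; first by move=> x _; exact: cst_continuous.
split=> [x _|v]; first exact: differentiable_cst.
rewrite (_ : (fun x => _) = fun=> 0) //.
by apply/funext => x; have -> : (fun=> c) = cst c by []; rewrite diff_cst.
Qed.

Lemma class_C_lin V W r (U : set V) (f : {linear V -> W}) :
  continuous f -> class_C r U f.
Proof.
case: r => [|r] cf /=; first by move=> x _; exact: cf.
split=> [x _|v]; first exact: linear_differentiable.
rewrite (_ : (fun x => _) = fun=> f v); first exact: class_C_cst.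
by apply/funext => x; rewrite diff_lin.
Qed.

Lemma class_C_add V W r (U : set V) (f g : V -> W) : open U ->
  class_C r U f -> class_C r U g -> class_C r U (fun x => f x + g x).
Proof.
move=> oU; elim: r f g => [|r IH] f g /=.
  by move=> Hf Hg x Ux; exact: cvgD (Hf _ Ux) (Hg _ Ux).
move=> [f1 f2] [g1 g2]; split=> [x Ux|v].
  exact: differentiableD (f1 _ Ux) (g1 _ Ux).
apply: class_C_ext (IH _ _ (f2 v) (g2 v)) => // x Ux /=.
by have /(congr1 (fun h => h v)) := diffD (f1 _ Ux) (g1 _ Ux).
Qed.

Lemma class_C_sum V W r (U : set V) (I : Type) (s : seq I) (P : pred I)
    (f : I -> V -> W) : open U ->
  (forall i, P i -> class_C r U (f i)) ->
  class_C r U (fun x => \sum_(i <- s | P i) f i x).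
Proof.
move=> oU H; elim: s => [|i s IH].
  by apply: class_C_ext (class_C_cst r U 0) => // x _; rewrite big_nil.
case Pi : (P i); last first.
  by apply: class_C_ext IH => // x _; rewrite big_cons Pi.
apply: class_C_ext (class_C_add oU (H _ Pi) IH) => // x _.
by rewrite big_cons Pi.
Qed.

Lemma class_C_mul V r (U : set V) (f g : V -> R^o) : open U ->
  class_C r U f -> class_C r U g -> class_C r U (fun x => f x * g x : R^o).
Proof.
move=> oU; elim: r f g => [|r IH] f g.
  by move=> /= Hf Hg x Ux; exact: cvgM (Hf _ Ux) (Hg _ Ux).
move=> Hf Hg; have [[f1 f2] [g1 g2]] := (Hf, Hg); split=> [x Ux|v].
  exact: (diff_mul (f1 _ Ux) (g1 _ Ux)).1.
apply: class_C_ext (class_C_add oU (IH _ _ (class_CW Hf) (g2 v))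
  (IH _ _ (class_CW Hg) (f2 v))) => // x Ux.
exact/esym/(diff_mul (f1 _ Ux) (g1 _ Ux)).2.
Qed.

Lemma class_C_opp V r (U : set V) (f : V -> R^o) : open U ->
  class_C r U f -> class_C r U (fun x => - f x : R^o).
Proof.
move=> oU H; apply: class_C_ext (class_C_mul oU (class_C_cst r U (-1 : R^o)) H).
  by [].
by move=> x _; rewrite mulN1r.
Qed.

(** In the derivative -f^(-2) f', the factor 1/f is of class C^r by induction, one order below what
    is being proved. *)
Lemma class_C_inv V r (U : set V) (f : V -> R^o) : open U ->
  (forall x, U x -> f x != 0) ->
  class_C r U f -> class_C r U (fun x => (f x)^-1 : R^o).
Proof.
move=> oU f0; elim: r => [|r IH] Hf.
  by move=> x Ux; exact: cvgV (f0 _ Ux) (Hf _ Ux).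
have [f1 f2] := Hf; split=> [x Ux|v].
  exact: (diff_inv (f1 _ Ux) (f0 _ Ux)).1.
have I := IH (class_CW Hf).
apply: class_C_ext (class_C_mul oU (class_C_opp oU (class_C_mul oU I I)) (f2 v)).
  by [].
by move=> x Ux; exact/esym/(diff_inv (f1 _ Ux) (f0 _ Ux)).2.
Qed.
End ClassC.

(** * Maps into row vectors, coordinatewise, and the chain rule in class C^r *)

Section RowVectors.
Variables (R : realType).

Lemma rv_normE n (u : 'rV[R]_n) : `|u| = \big[Num.max/0]_ij `|u ij.1 ij.2|.
Proof. by rewrite -mx_normrE. Qed.

Lemma rv_norm_le n (u : 'rV[R]_n) (c : R) : 0 <= c ->
  (forall j, `|u 0 j| <= c) -> `|u| <= c.
Proof.
move=> c0 H; rewrite rv_normE; apply/bigmax_leP; split=> // -[i j] _ /=.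
by rewrite ord1; exact: H.
Qed.

Lemma rv_norm_lt n (u : 'rV[R]_n) (c : R) : 0 < c ->
  (forall j, `|u 0 j| < c) -> `|u| < c.
Proof.
move=> c0 H; rewrite rv_normE; apply/bigmax_ltP; split=> // -[i j] _ /=.
by rewrite ord1; exact: H.
Qed.

Lemma rv_norm_coord n (u : 'rV[R]_n) j : `|u 0 j| <= `|u|.
Proof.
rewrite rv_normE.
by apply/bigmax_geP; right => /=; exists (0, j).
Qed.

Lemma diff_coord (V : normedModType R) n (psi : V -> 'rV[R]_n) x j :
  differentiable psi x ->
  differentiable (fun u => psi u 0 j : R^o) x /\
  forall v, 'd (fun u => psi u 0 j : R^o) x v = 'd psi x v 0 j.
Proof.
move=> dpsi.
pose p (M : 'rV[R]_n) : R^o := M 0 j.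
have lp : linear p by move=> a M N; rewrite /p !mxE.
pose pL : {linear _ -> _} := HB.pack p (GRing.isLinear.Build _ _ _ _ _ lp).
have cp : continuous pL by exact: coord_continuous.
have dp : differentiable pL (psi x) by exact: linear_differentiable.
split; first exact: (differentiable_comp dpsi dp).
move=> v; have := congr1 (fun h => h v) (diff_comp dpsi dp).
by rewrite (diff_lin _ cp).
Qed.

Lemma diff_row (V : normedModType R) n (psi : V -> 'rV[R]_n) x :
  (forall j, differentiable (fun u => psi u 0 j : R^o) x) ->
  differentiable psi x.
Proof.
move=> H; pose f j := (fun u => psi u 0 j *: (delta_mx 0 j : 'rV[R]_n)).
have -> : psi = \sum_j f j.
  by apply/funext => u; rewrite fct_sumE -row_sum_delta.
apply: differentiable_sum => j; exact: differentiableZl (H j).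
Qed.

Lemma continuous_row (V : normedModType R) n (psi : V -> 'rV[R]_n) x :
  (forall j, {for x, continuous (fun u => psi u 0 j : R^o)}) ->
  {for x, continuous psi}.
Proof.
move=> H; apply/cvgrPdist_lt => e e0.
have : \forall y \near x, forall j, `|psi x 0 j - psi y 0 j| < e.
  by apply: filter_forall => j; have /cvgrPdist_lt/(_ _ e0) := H j.
by apply: filterS => y Hy; apply: rv_norm_lt => // j; rewrite !mxE.
Qed.

(** [class_C] controls ['d f x v] for a fixed [v] only, whereas the chain rule evaluates ['d f] at a
    vector that moves with the point. Expanding this vector in the standard basis leaves products of
    functions with fixed directions, to which the induction hypothesis applies. *)
Lemma class_C_comp (V : normedModType R) n r (D : set V) (U : set 'rV[R]_n)
    (psi : V -> 'rV[R]_n) (f : 'rV[R]_n -> R^o) : open D ->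
  (forall u, D u -> U (psi u)) ->
  (forall j, class_C r D (fun u => psi u 0 j : R^o)) ->
  class_C r U f -> class_C r D (fun u => f (psi u)).
Proof.
move=> oD DU; elim: r f => [|r IH] f Hpsi Hf.
  move=> x Dx; apply: continuous_comp; last exact: Hf (DU _ Dx).
  by apply: continuous_row => j; exact: Hpsi j x Dx.
have dpsi x : D x -> differentiable psi x.
  by move=> Dx; apply: diff_row => j; exact: (Hpsi j).1.
have [f1 f2] := Hf.
have E x v : D x -> 'd (f \o psi) x v = \sum_j
    'd (fun u => psi u 0 j : R^o) x v * 'd f (psi x) (delta_mx 0 j).
  move=> Dx; have dx := dpsi _ Dx; have fx := f1 _ (DU _ Dx).
  apply: etrans (congr1 (fun h => h v) (diff_comp dx fx)) _ => /=.
  rewrite [X in 'd f (psi x) X]row_sum_delta linear_sum; apply: eq_bigr => j _.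
  by rewrite linearZ /= (diff_coord j dx).2.
split=> [x Dx|v].
  exact: differentiable_comp (dpsi _ Dx) (f1 _ (DU _ Dx)).
apply: class_C_ext (fun x Dx => esym (E x v Dx)) _ => //.
apply: class_C_sum => // j _; apply: class_C_mul => //.
  exact: (Hpsi j).2.
by apply: (IH (fun z => 'd f z (delta_mx 0 j))) (f2 _) => i; exact: class_CW.
Qed.

Lemma class_C_coord n r (U : set 'rV[R]_n) j :
  class_C r U (fun u : 'rV[R]_n => u 0 j : R^o).
Proof.
pose p (M : 'rV[R]_n) : R^o := M 0 j.
have lp : linear p by move=> a M N; rewrite /p !mxE.
pose pL : {linear _ -> _} := HB.pack p (GRing.isLinear.Build _ _ _ _ _ lp).
have cp : continuous pL by exact: coord_continuous.
exact: (class_C_lin _ _ cp).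
Qed.
End RowVectors.

Section Lines.
Variables (R : realType) (V : normedModType R).

Lemma is_derive_line (f : V -> R^o) (x v : V) (t : R) :
  differentiable f (x + t *: v) ->
  is_derive t 1 (fun s : R => f (x + s *: v)) ('d f (x + t *: v) v).
Proof.
move=> df; pose g (s : R) : V := x + s *: v.
have dg : is_diff t g ( *:%R^~ v).
  have := is_diffD (is_diff_cst x t) (is_diff_scalel t v).
  by rewrite add0r.
have dfg : differentiable (f \o g) t by exact: differentiable_comp.
apply: DeriveDef; first exact: diff_derivable.
rewrite deriveE // diff_comp //= (@diff_val _ _ _ _ _ _ _ dg) scale1r.
by [].
Qed.

Lemma mvt_line (f : V -> R^o) (x v : V) (a b : R) : a <= b ->
  (forall t, a <= t <= b -> differentiable f (x + t *: v)) ->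
  exists2 c, a <= c <= b &
    f (x + b *: v) - f (x + a *: v) = 'd f (x + c *: v) v * (b - a).
Proof.
move=> ab df.
have [t||c + E] := @MVT_segment R (fun s : R => f (x + s *: v))
  (fun t => 'd f (x + t *: v) v) a b ab.
- rewrite in_itv /= => /andP[/ltW ta /ltW tb].
  by apply: is_derive_line; apply: df; rewrite ta.
- apply: derivable_within_continuous => t; rewrite in_itv /= => tab.
  have D := is_derive_line (df _ tab); exact: ex_derive.
- by rewrite in_itv /= => cab; exists c.
Qed.
End Lines.

(** * The implicit function theorem *)

Section Insertion.
Variables (R : realType) (n : nat) (l : 'I_n.+1).

(** [del_coord] and [ins_coord] split R^(n+1) into the coordinate [l] and the others. The norm being
    the maximum norm, balls are products, and the two factors can be estimated separately. *)
Definition del_coord (x : 'rV[R]_n.+1) : 'rV[R]_n := \row_j x 0 (lift l j).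

Definition ins_coord (s : R) (u : 'rV[R]_n) : 'rV[R]_n.+1 :=
  \row_j (if unlift l j is Some j' then u 0 j' else s).

Lemma ins_coordl s u : ins_coord s u 0 l = s.
Proof. by rewrite mxE unlift_none. Qed.

Lemma ins_coord_lift s u j : ins_coord s u 0 (lift l j) = u 0 j.
Proof. by rewrite mxE liftK. Qed.

Lemma del_coordK (x : 'rV[R]_n.+1) : ins_coord (x 0 l) (del_coord x) = x.
Proof.
apply/rowP => j; case: (unliftP l j) => [j' ->|->]; last by rewrite ins_coordl.
by rewrite ins_coord_lift mxE.
Qed.

Lemma ins_coordD s u s' u' :
  ins_coord (s + s') (u + u') = ins_coord s u + ins_coord s' u'.
Proof.
apply/rowP => j; rewrite !mxE; by case: unliftP => [j' _|_]; rewrite ?mxE.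
Qed.

Lemma ins_coordZ a s u : ins_coord (a * s) (a *: u) = a *: ins_coord s u.
Proof.
apply/rowP => j; rewrite !mxE; by case: unliftP => [j' _|_]; rewrite ?mxE.
Qed.

Lemma ins_coordE s u : ins_coord s u = ins_coord 0 u + s *: delta_mx 0 l.
Proof.
apply/rowP => j; rewrite !mxE eqxx /=; case: unliftP => [j' ->|->].
  by rewrite eq_sym (negPf (neq_lift _ _)) mulr0 addr0.
by rewrite eqxx mulr1 add0r.
Qed.

Lemma norm_ins_coord_le s u c : `|s| <= c -> `|u| <= c -> `|ins_coord s u| <= c.
Proof.
move=> sc uc; apply: rv_norm_le => [|j]; first exact: le_trans sc.
case: (unliftP l j) => [j' ->|->]; last by rewrite ins_coordl.
by rewrite ins_coord_lift (le_trans (rv_norm_coord _ _)).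
Qed.

Lemma norm_ins_coord_lt s u c : `|s| < c -> `|u| < c -> `|ins_coord s u| < c.
Proof.
move=> sc uc; apply: rv_norm_lt => [|j]; first exact: le_lt_trans sc.
case: (unliftP l j) => [j' ->|->]; last by rewrite ins_coordl.
by rewrite ins_coord_lift (le_lt_trans (rv_norm_coord _ _)).
Qed.

Lemma norm_ins_coord0 u : `|ins_coord 0 u| = `|u|.
Proof.
apply/eqP; rewrite eq_le norm_ins_coord_le ?normr0 //=.
apply: rv_norm_le => // j; rewrite -(ins_coord_lift 0 u j).
exact: rv_norm_coord.
Qed.

Lemma norm_del_coord x : `|del_coord x| <= `|x|.
Proof. by apply: rv_norm_le => // j; rewrite mxE rv_norm_coord. Qed.

Lemma del_coordB x y : del_coord (x - y) = del_coord x - del_coord y.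
Proof. by apply/rowP => j; rewrite !mxE. Qed.

Lemma ins_coordB s u s' u' :
  ins_coord (s - s') (u - u') = ins_coord s u - ins_coord s' u'.
Proof.
apply/rowP => j; rewrite !mxE; by case: unliftP => [j' _|_]; rewrite ?mxE.
Qed.

End Insertion.

Lemma near_forall (T : topologicalType) (I : finType) (P : T -> I -> Prop) (x : T) :
  (forall i, \forall y \near x, P y i) -> \forall y \near x, forall i, P y i.
Proof. by move=> H; apply: (filter_forall (f := fun i y => P y i)). Qed.

(* Sealed, since unification tends to unfold ['d] when searching for structures on [R^o]. *)
HB.lock Definition dd (R : realType) (V : normedModType R) (f : V -> R) (x v : V) : R :=
  'd (f : V -> R^o) x v.

Section DD.
Variables (R : realType) (V : normedModType R).
Implicit Types (f : V -> R).

Lemma ddE f x : dd f x = 'd (f : V -> R^o) x.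
Proof. by apply/funext => v; rewrite dd.unlock. Qed.

Lemma ddD f x u v : dd f x (u + v) = dd f x u + dd f x v.
Proof. by rewrite ddE; exact: (raddfD ('d (f : V -> R^o) x)). Qed.

Lemma ddZ f x a v : dd f x (a *: v) = a * dd f x v.
Proof. by rewrite ddE; exact: linearZ_LR. Qed.

Lemma dd0 f x : dd f x 0 = 0.
Proof. by rewrite -(scale0r 0) ddZ mul0r. Qed.

Lemma dd_sum f x (I : Type) (s : seq I) (F : I -> V) :
  dd f x (\sum_(i <- s) F i) = \sum_(i <- s) dd f x (F i).
Proof.
elim: s => [|i s IH]; first by rewrite !big_nil dd0.
by rewrite !big_cons ddD IH.
Qed.

Lemma class_C_dd r U f : class_C r.+1 U (f : V -> R^o) ->
  (forall x, U x -> differentiable (f : V -> R^o) x) /\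
  (forall v, class_C r U (fun x => dd f x v : R^o)).
Proof.
move=> [f1 f2]; split=> // v; move: (f2 v).
by rewrite (_ : (fun x => _) = (fun x => dd f x v : R^o)) //; apply/funext => x; rewrite ddE.
Qed.

Lemma dd_eps f x : differentiable (f : V -> R^o) x ->
  forall e, 0 < e -> \forall h \near (0 : V),
    `|f (h + x) - f x - dd f x h| <= e * `|h|.
Proof. by rewrite ddE => df e e0; exact: (diff_eps df e0). Qed.

Lemma dd_of_eps f (df : V -> R) x : linear (df : V -> R^o) ->
  continuous (df : V -> R^o) ->
  (forall e, 0 < e -> \forall h \near (0 : V),
    `|f (h + x) - f x - df h| <= e * `|h|) ->
  differentiable (f : V -> R^o) x /\ dd f x = df.
Proof.
move=> ldf cdf H.
pose L : {linear V -> R^o} :=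
  HB.pack (df : V -> R^o) (GRing.isLinear.Build _ _ _ _ (df : V -> R^o) ldf).
have [D E] := @diff_of_eps R V R^o f L x cdf H.
by split=> //; rewrite ddE E.
Qed.

Lemma dd_mvt f (x v : V) (a b : R) : a <= b ->
  (forall t, a <= t <= b -> differentiable (f : V -> R^o) (x + t *: v)) ->
  exists2 c, a <= c <= b &
    f (x + b *: v) - f (x + a *: v) = dd f (x + c *: v) v * (b - a).
Proof. by move=> ab H; have [c cab E] := mvt_line ab H; exists c; rewrite // ddE. Qed.

End DD.

Lemma dd_row (R : realType) n (f : 'rV[R]_n -> R) x v :
  dd f x v = \sum_j v 0 j * dd f x (delta_mx 0 j).
Proof.
rewrite {1}(row_sum_delta v) dd_sum; apply: eq_bigr => j _.
by rewrite ddZ.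
Qed.

Lemma ler_dd_row (R : realType) n (f : 'rV[R]_n -> R) x v :
  `|dd f x v| <= (\sum_j `|dd f x (delta_mx 0 j)|) * `|v|.
Proof.
rewrite dd_row (le_trans (ler_norm_sum _ _ _))// mulr_suml.
by apply: ler_sum => j _; rewrite normrM mulrC ler_wpM2l// rv_norm_coord.
Qed.

Lemma continuous_pos (R : realType) (V : normedModType R) (f : V -> R^o) z :
  {for z, continuous f} -> 0 < f z ->
  exists2 r : R, 0 < r & forall y, `|y - z| < r -> 0 < f y.
Proof.
have aux (a b : R) : `|a - b| < a -> 0 < b by rewrite ltr_norml => /andP[_]; lra.
move=> /cvgrPdist_lt cf fz; have /nbhs_ballP[r r0 H] := cf _ fz.
exists r => // y yz; apply: (aux (f z)); apply: H.
by rewrite -ball_normE /= distrC.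
Qed.

Lemma lipschitz_linear_continuous (R : realType) (V W : normedModType R) (D : V -> W) (K : R) :
  linear D -> 0 <= K -> (forall h, `|D h| <= K * `|h|) -> continuous D.
Proof.
move=> lD K0 bD x; apply/cvgrPdist_lt => eps eps0.
have K1 : 0 < K + 1 by rewrite ltr_wpDl.
near=> y; have -> : D x - D y = D (x - y).
  have -> : x - y = -1 *: y + x by rewrite scaleN1r addrC.
  by rewrite lD scaleN1r addrC.
apply: (@le_lt_trans _ _ ((K + 1) * `|x - y|)).
  by rewrite (le_trans (bD _))// ler_wpM2r// lerDl.
rewrite -ltr_pdivlMl// mulrC; near: y; apply: cvgr_dist_lt => //.
by rewrite divr_gt0.
Unshelve. all: by end_near. Qed.

Lemma dd_coord (R : realType) n (j : 'I_n) (x : 'rV[R]_n) :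
  differentiable (fun u : 'rV[R]_n => u 0 j : R^o) x /\
  dd (fun u : 'rV[R]_n => u 0 j) x = (fun v => v 0 j).
Proof.
apply: dd_of_eps => [a u v||eps eps0]; first by rewrite !mxE.
  exact: coord_continuous.
near=> h; rewrite mxE addrK subrr normr0 mulr_ge0// ltW//.
Unshelve. all: by end_near. Qed.

Lemma dd_opp (R : realType) (V : normedModType R) (f : V -> R) x v :
  differentiable (f : V -> R^o) x -> dd (fun y => - f y) x v = - dd f x v.
Proof.
move=> df; rewrite !ddE.
exact: (congr1 (fun h : V -> R^o => h v) (diffN df)).
Qed.

Definition nball (R : realType) (V : normedModType R) (x : V) (d : R) : set V :=
  [set y | `|y - x| < d].

Lemma open_nball (R : realType) (V : normedModType R) (x : V) d : open (nball x d).
Proof.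
rewrite (_ : nball x d = ball x d); first exact: ball_open.
by apply/funext => y; rewrite -ball_normE /= /nball /= distrC.
Qed.

Section ImplicitFunction.
Variables (R : realType) (n : nat) (l : 'I_n.+1).
Let e : 'rV[R]_n.+1 := delta_mx 0 l.

(** Continuity of the partial derivatives at [x0]: [c] is half of the derivative along [e] there,
    and [M] is the sum of the absolute partial derivatives, each enlarged by 1, which bounds the
    operator norm for the maximum norm. *)
Lemma implicit_data (k : nat) (U : set 'rV[R]_n.+1) (f : 'rV[R]_n.+1 -> R) x0 :
  open U -> class_C k.+1 U (f : _ -> R^o) -> U x0 -> 0 < dd f x0 e ->
  exists c M rho : R, [/\ 0 < c, 0 <= M, 0 < rho &
    forall x, `|x - x0| < rho -> [/\ U x, c <= dd f x e &
      forall v, `|dd f x v| <= M * `|v|]].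
Proof.
have half (a b : R) : `|a - b| <= a / 2 -> a / 2 <= b.
  by rewrite ler_norml => /andP[_]; lra.
have near1 (a b : R) : `|a - b| <= 1 -> `|b| <= `|a| + 1.
  by rewrite -lerBlDl distrC; apply: le_trans; exact: lerB_dist.
move=> oU /class_C_dd[f1 f2] Ux0 c0.
exists (dd f x0 e / 2), (\sum_j (`|dd f x0 (delta_mx 0 j)| + 1)).
have cont j : {for x0, continuous (fun x => dd f x (delta_mx 0 j))}.
  exact: class_C_continuous (f2 (delta_mx 0 j)) Ux0.
have H1 : \forall x \near x0, U x by exact: open_nbhs_nbhs.
have H2 : \forall x \near x0, dd f x0 e / 2 <= dd f x e.
  have := cont l => /cvgrPdist_le/(_ (dd f x0 e / 2)).
  rewrite divr_gt0// => /(_ isT); apply: filterS => x.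
  exact: half.
  
have H3 : \forall x \near x0, forall j : 'I_n.+1,
    `|dd f x (delta_mx 0 j)| <= `|dd f x0 (delta_mx 0 j)| + 1.
  apply: near_forall => j; have /cvgrPdist_le/(_ _ ltr01) := cont j.
  apply: filterS => x; exact: near1.
have /nbhs_ballP[rho rho0 H] : \forall x \near x0, [/\ U x,
    dd f x0 e / 2 <= dd f x e & forall j : 'I_n.+1,
    `|dd f x (delta_mx 0 j)| <= `|dd f x0 (delta_mx 0 j)| + 1].
  by near=> x; split; near: x.
exists rho; split=> //; first by rewrite divr_gt0.
  by apply: sumr_ge0 => j _; rewrite addr_ge0.
move=> x xx0; have [|Ux cx Mx] := H x.
  by rewrite -ball_normE /= distrC.
split=> // v; apply: le_trans (ler_dd_row _ _ _) _.
by rewrite ler_wpM2r//; apply: ler_sum => j _.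
Unshelve. all: by end_near. Qed.

Section Local.
Variables (f : 'rV[R]_n.+1 -> R) (x0 : 'rV[R]_n.+1) (c M rho : R).
Hypotheses (c0 : 0 < c) (M0 : 0 <= M) (rho0 : 0 < rho) (fx0 : f x0 = 0).
Hypothesis df : forall x, `|x - x0| < rho -> differentiable (f : _ -> R^o) x.
Hypothesis ge_c : forall x, `|x - x0| < rho -> c <= dd f x e.
Hypothesis le_M : forall x v, `|x - x0| < rho -> `|dd f x v| <= M * `|v|.
Let s0 := x0 0 l.
Let u0 := del_coord l x0.

Let near_ins s u : `|s - s0| < rho -> `|u - u0| < rho ->
  `|ins_coord l s u - x0| < rho.
Proof.
by move=> *; rewrite -(del_coordK l x0) -ins_coordB; exact: norm_ins_coord_lt.
Qed.

Let slope s s' u : `|u - u0| < rho -> `|s - s0| < rho -> `|s' - s0| < rho ->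
  s <= s' -> c * (s' - s) <= f (ins_coord l s' u) - f (ins_coord l s u).
Proof.
move=> uu ss ss' lss; rewrite (ins_coordE l s) (ins_coordE l s').
have btw t : s <= t <= s' -> `|t - s0| < rho.
  move: ss ss'; rewrite !ltr_norml => /andP[? _] /andP[_ ?] /andP[? ?].
  by apply/andP; split; lra.
have [|t tt ->] := dd_mvt (f := f) (x := ins_coord l 0 u) (v := e) lss.
  by move=> t tt; rewrite -ins_coordE; apply: df; apply: near_ins => //; exact: btw.
rewrite ler_wpM2r ?subr_ge0// -ins_coordE; apply: ge_c.
by apply: near_ins => //; exact: btw.
Qed.

Let slope_abs s s' u : `|u - u0| < rho -> `|s - s0| < rho -> `|s' - s0| < rho ->
  c * `|s' - s| <= `|f (ins_coord l s' u) - f (ins_coord l s u)|.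
Proof.
move=> uu ss ss'; have [ss1|/ltW ss1] := leP s s'.
  by rewrite ger0_norm ?subr_ge0// (le_trans (slope uu ss ss' ss1))// ler_norm.
rewrite distrC ger0_norm ?subr_ge0// (le_trans (slope uu ss' ss ss1))//.
by rewrite distrC ler_norm.
Qed.

(** Strictly below [rho], so that the closed interval of radius [d1] around [s0] stays where the
    derivatives are controlled. *)
Let d1 := rho / 2.

(** Along [e] the function increases with slope at least [c], so it is positive at [s0 + d1] and
    negative at [s0 - d1] over [u0]. Both signs persist for [u] near [u0], and the intermediate
    value theorem gives the zero. *)
Lemma implicit_solve : exists2 d : R, 0 < d <= d1 &
  forall u, `|u - u0| < d -> exists2 s, `|s - s0| <= d1 & f (ins_coord l s u) = 0.
Proof.
have d10 : 0 < d1 by rewrite divr_gt0.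
have d1r : d1 < rho by rewrite ltr_pdivrMr// ltr_pMr// ltr1n.
have u00 : `|u0 - u0| < rho by rewrite subrr normr0.
have s00 : `|s0 - s0| < rho by rewrite subrr normr0.
have f00 : f (ins_coord l s0 u0) = 0 by rewrite del_coordK.
have sp : `|s0 + d1 - s0| = d1 by rewrite addrC addKr gtr0_norm.
have sm : `|s0 - d1 - s0| = d1 by rewrite addrC addKr normrN gtr0_norm.
have fp : 0 < f (ins_coord l (s0 + d1) u0).
  have := @slope s0 (s0 + d1) u0 u00 s00; rewrite sp f00 subr0 => /(_ d1r).
  rewrite lerDl (ltW d10) => /(_ isT); apply: lt_le_trans.
  by rewrite [s0 + d1]addrC addrK mulr_gt0.
have fm : 0 < - f (ins_coord l (s0 - d1) u0).
  have := @slope (s0 - d1) s0 u0 u00; rewrite sm f00 sub0r => /(_ d1r s00).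
  rewrite gerBl (ltW d10) => /(_ isT); apply: lt_le_trans.
  by rewrite opprB addrC subrK mulr_gt0.
have cont s : `|s - s0| < rho -> {for ins_coord l s u0, continuous (f : _ -> R^o)}.
  by move=> ss; apply: differentiable_continuous; apply: df; exact: near_ins.
have [r1 r10 H1] : exists2 r : R, 0 < r &
    forall u, `|u - u0| < r -> 0 < f (ins_coord l (s0 + d1) u).
  have [|r r0 H] := continuous_pos (cont (s0 + d1) _) fp; first by rewrite sp.
  by exists r => // u uu; apply: H; rewrite -ins_coordB subrr norm_ins_coord0.
have [r2 r20 H2] : exists2 r : R, 0 < r &
    forall u, `|u - u0| < r -> 0 < - f (ins_coord l (s0 - d1) u).
  have cN : {for ins_coord l (s0 - d1) u0, continuous (fun x => - f x : R^o)}.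
    have cs : {for ins_coord l (s0 - d1) u0, continuous (f : _ -> R^o)}.
      by apply: cont; rewrite sm.
    exact: cvgN cs.
  have [r r0 H] := continuous_pos cN fm.
  by exists r => // u uu; apply: H; rewrite -ins_coordB subrr norm_ins_coord0.
exists (Num.min d1 (Num.min r1 r2)).
  by rewrite ge_min lexx !lt_min d10 r10 r20.
move=> u; rewrite !lt_min => /and3P[ud /H1 fp1 /H2 fm1].
have ur : `|u - u0| < rho by exact: lt_trans ud _.
have ab : s0 - d1 <= s0 + d1 by rewrite lerD2l ge0_cp// ltW.
have btw t : s0 - d1 <= t <= s0 + d1 -> `|t - s0| <= d1.
  by rewrite ler_distl.
have [||t] := @IVT R (fun s : R => f (ins_coord l 0 u + s *: e))
    (s0 - d1) (s0 + d1) 0 ab.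
- apply: derivable_within_continuous => t; rewrite in_itv /= => /btw tt.
  have D : differentiable (f : _ -> R^o) (ins_coord l 0 u + t *: e).
    by rewrite -ins_coordE; apply: df; apply: near_ins => //; exact: le_lt_trans d1r.
  by have := is_derive_line D => ?; exact: ex_derive.
- rewrite -!ins_coordE ge_min le_max (ltW fp1) orbT andbT.
  by rewrite -oppr_ge0 (ltW fm1).
- by rewrite in_itv /= => /btw tt; rewrite -ins_coordE; exists t.
Qed.

Lemma implicit_unique s s' u : `|u - u0| < rho -> `|s - s0| <= d1 -> `|s' - s0| <= d1 ->
  f (ins_coord l s u) = 0 -> f (ins_coord l s' u) = 0 -> s = s'.
Proof.
have d1r : d1 < rho by rewrite ltr_pdivrMr// ltr_pMr// ltr1n.
move=> uu ss ss' E E'.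
have := slope_abs uu (le_lt_trans ss d1r) (le_lt_trans ss' d1r).
rewrite E E' subr0 normr0 pmulr_rle0// normr_le0 subr_eq0.
by move/eqP.
Qed.

Section Solution.
Variables (d : R) (eta : 'rV[R]_n -> R).
Hypothesis d_le : d <= d1.
Hypothesis eta_near : forall u, `|u - u0| < d -> `|eta u - s0| <= d1.
Hypothesis f_eta : forall u, `|u - u0| < d -> f (ins_coord l (eta u) u) = 0.

Lemma implicit_near u : `|u - u0| < d -> `|ins_coord l (eta u) u - x0| < rho.
Proof.
have d1r : d1 < rho by rewrite ltr_pdivrMr// ltr_pMr// ltr1n.
move=> uu; apply: near_ins; first exact: le_lt_trans (eta_near uu) d1r.
by apply: lt_trans uu _; exact: le_lt_trans d1r.
Qed.

(** The slope bound first makes the increment [D] of [eta] at most a constant times [|h|]. Expanding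
    [f] at [z] along the increment ([D], [h]), where both values of [f] vanish, then gives 0 =
    [dd f z (ins_coord l 0 h)] + [D * a] + o(|h|), and one divides by [a]. *)
Lemma implicit_diff u : `|u - u0| < d ->
  differentiable (eta : _ -> R^o) u /\
  dd eta u = (fun h => - dd f (ins_coord l (eta u) u) (ins_coord l 0 h) /
                       dd f (ins_coord l (eta u) u) e).
Proof.
have d1r : d1 < rho by rewrite ltr_pdivrMr// ltr_pMr// ltr1n.
move=> uu; have zz := implicit_near uu.
set z := ins_coord l (eta u) u in zz *; set a := dd f z e.
have ca : c <= a by exact: ge_c.
have a0 : 0 < a by exact: lt_le_trans ca.
have bnd h : `|- dd f z (ins_coord l 0 h) / a| <= M / c * `|h|.
  rewrite normrM normrN normfV (gtr0_norm a0) mulrAC.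
  apply: ler_pM => //; first by rewrite invr_ge0 ltW.
    by rewrite -(norm_ins_coord0 l) le_M.
  by rewrite lef_pV2.
have aux (t p q : R) : - (t * p + q) / a = t * (- p / a) + - q / a.
  by rewrite opprD mulrDl !mulNr mulrN mulrA.
have lin : linear ((fun h => - dd f z (ins_coord l 0 h) / a) : 'rV[R]_n -> R^o).
  move=> t h h' /=; have -> : ins_coord l (0 : R) (t *: h + h') =
      t *: ins_coord l 0 h + ins_coord l 0 h'.
    by rewrite -ins_coordZ mulr0 -ins_coordD addr0.
  rewrite ddD ddZ; exact: aux.
apply: dd_of_eps => //.
  apply: (lipschitz_linear_continuous lin _ bnd).
  by rewrite divr_ge0 // ltW.
move=> eps eps0.
(* [K] bounds the whole increment ([D], [h]) by [K * |h|]; [eps1] is such that [eps1 * K = eps * c],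
   and [c <= a]. *)
pose K := (M + 1) / c + 1.
have K1 : 1 <= K by rewrite lerDr divr_ge0 ?addr_ge0// ltW.
have K0 : 0 < K by exact: lt_le_trans K1.
pose eps1 := eps * c / K.
have eps10 : 0 < eps1 by rewrite !mulr_gt0// invr_gt0.
have /nbhs_ballP[r r0 Hr] : \forall w \near (0 : 'rV[R]_n.+1),
    `|f (w + z) - f z - dd f z w| <= 1 * `|w| /\
    `|f (w + z) - f z - dd f z w| <= eps1 * `|w|.
  have E1 := dd_eps (df zz) ltr01; have E2 := dd_eps (df zz) eps10.
  by near=> w; split; near: w.
have {}Hr w : `|w| < r ->
    `|f (w + z) - f z - dd f z w| <= 1 * `|w| /\
    `|f (w + z) - f z - dd f z w| <= eps1 * `|w|.
  by move=> wr; apply: Hr; rewrite -ball_normE /= sub0r normrN.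
have fz : f z = 0 by exact: f_eta.
pose r' := Num.min (r / K) (d - `|u - u0|).
have r'0 : 0 < r' by rewrite lt_min divr_gt0//= subr_gt0.
apply/nbhs_ballP; exists r' => // h.
rewrite -ball_normE /= sub0r normrN lt_min => /andP[hr hd].
have Kh : K * `|h| < r by rewrite mulrC -ltr_pdivlMr.
have hh : `|h + u - u0| < d.
  by rewrite -addrA (le_lt_trans (ler_normD _ _))// -ltrBrDr.
pose D := eta (h + u) - eta u.
have hu0 : `|h + u - u0| < rho.
  by apply: lt_trans hh _; exact: le_lt_trans d1r.
have /Hr[Hw1 _] : `|ins_coord l 0 h| < r.
  by rewrite norm_ins_coord0 (le_lt_trans _ Kh)// ler_peMl.
have w1z : ins_coord l 0 h + z = ins_coord l (eta u) (h + u).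
  by rewrite /z -ins_coordD add0r.
(* Only the coordinate [l] moves between the two points compared: one is a zero of [f], and at the
   other the first-order expansion at [z], with error at most [|h|], bounds [f]. *)
have cD : c * `|D| <= (M + 1) * `|h|.
  have := slope_abs hu0 (le_lt_trans (eta_near uu) d1r)
    (le_lt_trans (eta_near hh) d1r).
  move=> H; apply: le_trans H _; rewrite f_eta// sub0r normrN -w1z.
  rewrite mulrDl mul1r -lerBlDl.
  have := le_M (ins_coord l 0 h) zz; rewrite norm_ins_coord0 => Mh.
  apply: le_trans (lerB _ Mh) _; first exact: lexx.
  rewrite (le_trans (lerB_dist _ _))//.
  by move: Hw1; rewrite fz subr0 mul1r norm_ins_coord0.
have DK : `|D| <= K * `|h|.
  rewrite /K mulrDl mul1r ler_wpDr// mulrAC ler_pdivlMr// mulrC.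
  exact: cD.
have wK : `|ins_coord l D h| <= K * `|h|.
  by apply: norm_ins_coord_le => //; rewrite ler_peMl.
have /Hr[_ Hw2] : `|ins_coord l D h| < r by exact: le_lt_trans Kh.
have wz : ins_coord l D h + z = ins_coord l (eta (h + u)) (h + u).
  by rewrite /z -ins_coordD subrK.
move: Hw2; rewrite wz fz f_eta// subrr sub0r normrN (ins_coordE l D) ddD ddZ -/a.
move=> Hw2.
have -> : eta (h + u) - eta u - - dd f z (ins_coord l 0 h) / a =
    (dd f z (ins_coord l 0 h) + D * a) / a.
  by rewrite -/D mulrDl mulfK ?gt_eqF// mulNr opprK addrC.
rewrite normrM normfV (gtr0_norm a0) ler_pdivrMr// (le_trans Hw2)//.
rewrite -ins_coordE (@le_trans _ _ (eps1 * (K * `|h|)))//.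
  by rewrite ler_wpM2l// ltW.
rewrite /eps1 mulrA divfK ?gt_eqF// -mulrA [c * _]mulrC mulrA.
by rewrite ler_wpM2l// mulr_ge0// ltW.
Unshelve. all: by end_near. Qed.
End Solution.

End Local.

Lemma class_C_ins_coord k (D : set 'rV[R]_n) (eta : 'rV[R]_n -> R) j :
  class_C k D (eta : _ -> R^o) -> class_C k D (fun u => ins_coord l (eta u) u 0 j : R^o).
Proof.
move=> Heta; case: (unliftP l j) => [j' ->|->].
  rewrite (_ : (fun u => _) = (fun u : 'rV[R]_n => u 0 j' : R^o)); first exact: class_C_coord.
  by apply/funext => u; rewrite ins_coord_lift.
rewrite (_ : (fun u => _) = (eta : _ -> R^o)) //.
by apply/funext => u; rewrite ins_coordl.
Qed.

Lemma implicit_chart_pos (k : nat) (U : set 'rV[R]_n.+1) (f : 'rV[R]_n.+1 -> R) x0 :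
  open U -> class_C k.+1 U (f : _ -> R^o) -> U x0 -> f x0 = 0 -> 0 < dd f x0 e ->
  exists d L eps (iota : 'rV[R]_n -> 'rV[R]_n.+1), let D := nball (del_coord l x0) d in
  [/\ 0 < d /\ 0 < eps,
      forall u, D u -> U (iota u) /\ f (iota u) = 0,
      forall j, class_C k.+1 D (fun u => iota u 0 j : R^o),
      forall j u v, D u -> `|dd (fun u => iota u 0 j) u v| <= L * `|v| &
      forall x, `|x - x0| <= eps -> f x = 0 ->
        D (del_coord l x) /\ iota (del_coord l x) = x].
Proof.
move=> oU Hf Ux0 fx0 pos.
have [c [M [rho [c0 M0 rho0 H]]]] := implicit_data oU Hf Ux0 pos.
have [fdiff fdd] := class_C_dd Hf.
have HU x : `|x - x0| < rho -> U x by move=> /H[].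
have Hdf x : `|x - x0| < rho -> differentiable (f : _ -> R^o) x by move=> /HU /fdiff.
have Hc x : `|x - x0| < rho -> c <= dd f x e by move=> /H[].
have HM x v : `|x - x0| < rho -> `|dd f x v| <= M * `|v| by move=> /H[_ _]; exact.
have [d /andP[d0 dd1] Hsol] := implicit_solve c0 rho0 fx0 Hdf Hc.
pose S u : set R := [set s | `|s - x0 0 l| <= rho / 2 /\ f (ins_coord l s u) = 0].
pose eta u := xget 0 (S u).
have Heta u : `|u - del_coord l x0| < d -> S u (eta u).
  by move=> /Hsol[s ss fs]; apply: (@xgetPex _ 0 (S u)); exists s.
have eta1 u : `|u - del_coord l x0| < d -> `|eta u - x0 0 l| <= rho / 2.
  by move=> /Heta[].
have eta2 u : `|u - del_coord l x0| < d -> f (ins_coord l (eta u) u) = 0.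
  by move=> /Heta[].
have eta_rho u : `|u - del_coord l x0| < d -> `|ins_coord l (eta u) u - x0| < rho.
  exact: (implicit_near rho0 dd1 eta1).
have eta_diff u : `|u - del_coord l x0| < d -> differentiable (eta : _ -> R^o) u /\
    dd eta u = (fun h => - dd f (ins_coord l (eta u) u) (ins_coord l 0 h) /
                       dd f (ins_coord l (eta u) u) e).
  exact: (implicit_diff c0 M0 rho0 Hdf Hc HM dd1 eta1 eta2).
pose D := nball (del_coord l x0) d.
have oD : open D by exact: open_nball.
(* Bootstrapping: the derivative of [eta] is a quotient of derivatives of [f] along the graph of
   [eta], hence as regular as [eta] itself, until the regularity of [dd f] is exhausted. *)
have class_eta j : (j <= k.+1)%N -> class_C j D (eta : _ -> R^o).
  elim: j => [_|j IH jk].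
    by move=> u /eta_diff[/differentiable_continuous].
  have {}IH := IH (ltnW jk).
  split; first by move=> u /eta_diff[].
  move=> v.
  have Hiota i : class_C j D (fun u => ins_coord l (eta u) u 0 i : R^o).
    exact: class_C_ins_coord.
  have DU u : D u -> U (ins_coord l (eta u) u) by move=> Du; apply: HU; exact: eta_rho.
  have comp w : class_C j D (fun u => dd f (ins_coord l (eta u) u) w : R^o).
    apply: (class_C_comp (f := fun z => dd f z w : R^o) oD DU Hiota).
    exact: class_C_le (fdd w).
  have ne0 u : D u -> dd f (ins_coord l (eta u) u) e != 0.
    by move=> Du; rewrite gt_eqF// (lt_le_trans c0)// Hc// eta_rho.
  have Q := class_C_mul oD (class_C_opp oD (comp (ins_coord l 0 v)))
    (class_C_inv oD ne0 (comp e)).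
  apply: class_C_ext Q => // u Du.
  by rewrite -ddE (eta_diff _ Du).2.
(* [M / c] bounds the derivative of [eta], and the added 1 covers the coordinates on which the graph
   is the identity. In the radius, [rho / 2] is for uniqueness and [d / 2] puts the projection
   strictly inside [D]. *)
exists d, (M / c + 1), (Num.min (rho / 2) (d / 2)), (fun u => ins_coord l (eta u) u).
have Mc0 : 0 <= M / c by rewrite divr_ge0// ltW.
split.
- by split=> //; rewrite lt_min !divr_gt0.
- by move=> u Du; split; [apply: HU; exact: eta_rho|exact: eta2].
- by move=> j; apply: (@class_C_ins_coord k.+1 D); exact: class_eta.
- move=> j u v Du; case: (unliftP l j) => [j' ->|->].
    rewrite (_ : (fun u => _) = (fun u : 'rV[R]_n => u 0 j')); last first.
      by apply/funext => w; rewrite ins_coord_lift.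
    rewrite (dd_coord _ _).2 (le_trans (rv_norm_coord _ _))//.
    by rewrite ler_peMl// lerDr.
  rewrite (_ : (fun u => _) = eta); last by apply/funext => w; rewrite ins_coordl.
  have zz := eta_rho _ Du; have ac := Hc _ zz.
  have a0 := lt_le_trans c0 ac.
  rewrite (eta_diff _ Du).2 mulrDl mul1r ler_wpDr//.
  rewrite normrM normrN normfV (gtr0_norm a0) mulrAC.
  apply: ler_pM => //; first by rewrite invr_ge0 ltW.
    by rewrite -(norm_ins_coord0 l) HM.
  by rewrite lef_pV2.
- move=> x; rewrite le_min => /andP[xr xd] fx.
  have Dx : D (del_coord l x).
    rewrite /D /nball /= -del_coordB (le_lt_trans (norm_del_coord _ _))//.
    by rewrite (le_lt_trans xd)// ltr_pdivrMr// ltr_pMr// ltr1n.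
  split => //; rewrite -[in RHS](del_coordK l x); congr (ins_coord l _ _).
  apply: (@implicit_unique f x0 c rho c0 rho0 Hdf Hc _ _ (del_coord l x)).
  + by apply: lt_le_trans Dx _; rewrite (le_trans dd1)// ler_pdivrMr// ler_pMr// ler1n.
  + exact: eta1.
  + by have := rv_norm_coord (x - x0) l; rewrite !mxE => /le_trans; exact.
  + exact: eta2.
  + by rewrite del_coordK.
Qed.

Lemma implicit_chart (k : nat) (U : set 'rV[R]_n.+1) (f : 'rV[R]_n.+1 -> R) x0 :
  open U -> class_C k.+1 U (f : _ -> R^o) -> U x0 -> f x0 = 0 -> dd f x0 e != 0 ->
  exists d L eps (iota : 'rV[R]_n -> 'rV[R]_n.+1), let D := nball (del_coord l x0) d in
  [/\ 0 < d /\ 0 < eps,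
      forall u, D u -> U (iota u) /\ f (iota u) = 0,
      forall j, class_C k.+1 D (fun u => iota u 0 j : R^o),
      forall j u v, D u -> `|dd (fun u => iota u 0 j) u v| <= L * `|v| &
      forall x, `|x - x0| <= eps -> f x = 0 ->
        D (del_coord l x) /\ iota (del_coord l x) = x].
Proof.
move=> oU Hf Ux0 fx0; have [neg _|pos _|//] := ltrgtP (dd f x0 e) 0.
  have HN : class_C k.+1 U (fun x => - f x : R^o) by exact: class_C_opp.
  have fN0 : - f x0 = 0 by rewrite fx0 oppr0.
  have pN : 0 < dd (fun x => - f x) x0 e.
    by rewrite dd_opp ?oppr_gt0//; exact: (class_C_dd Hf).1.
  have [d [L [eps [iota [H0 H1 H2 H3 H4]]]]] := implicit_chart_pos oU HN Ux0 fN0 pN.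
  exists d, L, eps, iota; split => //.
    by move=> u /H1[Uu /eqP]; rewrite oppr_eq0 => /eqP.
  by move=> x xe fx; apply: H4 => //; rewrite fx oppr0.
exact: implicit_chart_pos oU Hf Ux0 fx0 pos.
Qed.
End ImplicitFunction.

(** * Morse's lemma *)

Section Compactness.
Variables (R : realType).

(** Compactness of the pieces is built in since the intended [I], having an image with empty
    interior, is stable under countable unions of compact pieces only. *)
Definition sigma_ideal (T : topologicalType) (I : set T -> Prop) :=
  forall (J : countType) (A : set T) (As : J -> set T),
    (forall i, compact (As i)) -> (forall i, I (As i)) ->
    A `<=` \bigcup_i As i -> I A.

Lemma compact_preimage (T S : topologicalType) (A : set T) (Z : set S) (g : T -> S) :
  compact A -> (forall x, A x -> {for x, continuous g}) -> closed Z ->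
  compact (A `&` g @^-1` Z).
Proof.
move=> cA cg cZ F FF FAZ.
have FA : F A by apply: filterS FAZ => x [].
have [p [Ap clp]] := cA F FF FA; exists p; split => //; split => //.
apply: cZ => N /(cg p Ap) gN.
by have [q [[_ Zq] Nq]] := clp _ _ FAZ gN; exists (g q).
Qed.

Definition cball (V : normedModType R) (x : V) (d : R) : set V :=
  [set y | `|y - x| <= d].

Lemma closed_cball (V : normedModType R) (x : V) d : closed (cball x d).
Proof.
apply: (@preimage_closed _ _ (fun y : V => `|y - x|) [set t : R | t <= d]).
  by move=> y _; apply: cvg_norm; apply: cvgB; [exact: cvg_id|exact: cvg_cst].
exact: closed_le.
Qed.

Lemma compact_local (V : normedModType R) (I : set V -> Prop) (A : set V) :
  sigma_ideal I -> compact A ->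
  (forall x, A x -> exists2 e : R, 0 < e & I (A `&` cball x e)) -> I A.
Proof.
move=> sI cA H.
pose e (x : V) : R := xget 0 [set e | 0 < e /\ I (A `&` cball x e)].
have He x : A x -> 0 < e x /\ I (A `&` cball x (e x)).
  by move=> /H[r r0 Ir]; apply: (@xgetPex _ 0 [set e | 0 < e /\ I (A `&` cball x e)]); exists r.
have := cA; rewrite compact_cover => /(_ V A (fun x => nball x (e x))) [].
- by move=> x _; exact: open_nball.
- by move=> x Ax; exists x => //; rewrite /nball /= subrr normr0 (He x Ax).1.
move=> D DA cov; pose s : seq V := finmap.enum_fset D.
apply: (sI 'I_(size s) A
  (fun i => A `&` cball (tnth (in_tuple s) i) (e (tnth (in_tuple s) i)))).
- by move=> i; apply: compact_closedI => //; exact: closed_cball.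
- by move=> i; apply: (He _ _).2; apply/set_mem/DA; exact: mem_tnth.
- move=> x Ax; have [y /= yD xy] := cov x Ax.
  have ys : y \in s by [].
  have [i yi] := tnthP (in_tuple s) y ys; exists i => //=.
  by rewrite -yi; split => //; exact: ltW.
Qed.
End Compactness.

Section Charts.
Variables (R : realType).

Lemma dd_comp (V : normedModType R) n (psi : V -> 'rV[R]_n) (f : 'rV[R]_n -> R) u :
  (forall j, differentiable (fun w => psi w 0 j : R^o) u) ->
  differentiable (f : _ -> R^o) (psi u) ->
  differentiable (fun w => f (psi w) : R^o) u /\
  forall v, dd (fun w => f (psi w)) u v =
    \sum_j dd (fun w => psi w 0 j) u v * dd f (psi u) (delta_mx 0 j).
Proof.
move=> dj df; have dpsi := diff_row dj.
split; first exact: differentiable_comp dpsi df.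
move=> v; have E : dd (fun w => f (psi w)) u v = dd f (psi u) ('d psi u v).
  rewrite !ddE; exact: (congr1 (fun h : V -> R^o => h v) (diff_comp dpsi df)).
rewrite E dd_row; apply: eq_bigr => j _; congr (_ * _).
by rewrite ddE; have [_ /(_ v) ->] := diff_coord j dpsi.
Qed.

(** A parametrization of which only differentiability with bounded partial derivatives is kept;
    injectivity is not asked for. The domain is a ball, hence convex, for the mean value theorem. *)
Definition chart n q (U : set 'rV[R]_n) (psi : 'rV[R]_q -> 'rV[R]_n) u0 d L :=
  forall u, nball u0 d u -> U (psi u) /\ forall j,
    differentiable (fun w => psi w 0 j : R^o) u /\
    forall v, `|dd (fun w => psi w 0 j) u v| <= L * `|v|.

Lemma nball_convex (V : normedModType R) (u0 x u : V) d t : 0 <= t <= 1 ->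
  nball u0 d x -> nball u0 d u -> nball u0 d (x + t *: (u - x)).
Proof.
move=> /andP[t0 t1]; rewrite /nball /= => xd ud.
have -> : x + t *: (u - x) - u0 = (1 - t) *: (x - u0) + t *: (u - u0).
  have -> : u - x = (u - u0) - (x - u0) by rewrite opprB addrA subrK.
  by rewrite scalerBr scalerBl scale1r addrAC -[RHS]addrA [- _ + _]addrC.
rewrite (le_lt_trans (ler_normD _ _))// !normrZ !ger0_norm ?subr_ge0//.
have [->|/eqP t_neq0] := eqVneq t 0; first by rewrite subr0 mul1r mul0r addr0.
have -> : d = (1 - t) * d + t * d by rewrite -mulrDl subrK mul1r.
apply: ler_ltD; first by rewrite ler_wpM2l ?subr_ge0// ltW.
by rewrite ltr_pM2l// lt_neqAle t0 andbT eq_sym; apply/eqP.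
Qed.

(** By the mean value theorem on the segment from [x] to [u], the difference is a derivative along
    [u - x]: the direction supplies one factor [|u - x|], and the bound on the partial derivatives
    of [g] the other [k], since intermediate points are no farther from [x] than [u]. *)
Lemma chart_flat n q k (U : set 'rV[R]_n) (psi : 'rV[R]_q -> 'rV[R]_n) u0 d L
    (B : set 'rV[R]_q) (g : 'rV[R]_n -> R) :
  chart U psi u0 d L -> B `<=` nball u0 d ->
  (forall x, U x -> differentiable (g : _ -> R^o) x) ->
  (forall j, exists C, forall x u, B x -> nball u0 d u ->
    `|dd g (psi u) (delta_mx 0 j)| <= C * `|u - x| ^+ k) ->
  exists C, forall x u, B x -> nball u0 d u ->
    `|g (psi u) - g (psi x)| <= C * `|u - x| ^+ k.+1.
Proof.
move=> Hpsi BD dg /choice[C HC].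
exists (\sum_j `|L| * `|C j|) => x u Bx Du.
have Dw t : 0 <= t <= 1 -> nball u0 d (x + t *: (u - x)).
  by move=> t01; apply: nball_convex => //; exact: BD.
have dgp w : nball u0 d w -> differentiable (fun w => g (psi w) : R^o) w /\
  forall v, dd (fun w => g (psi w)) w v =
    \sum_j dd (fun w => psi w 0 j) w v * dd g (psi w) (delta_mx 0 j).
  move=> Dw'; have [Uw Hw] := Hpsi _ Dw'; apply: dd_comp; last exact: dg.
  by move=> j; have [] := Hw j.
have [|c c01] := @dd_mvt R _ (fun w => g (psi w)) x (u - x) 0 1 ler01.
  by move=> t t01; have [] := dgp _ (Dw _ t01).
rewrite scale1r scale0r addr0 [x + (u - x)]addrC subrK subr0 mulr1 => ->.
rewrite (dgp _ (Dw _ c01)).2 (le_trans (ler_norm_sum _ _ _))// mulr_suml.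
apply: ler_sum => j _; rewrite normrM exprS.
have -> : `|L| * `|C j| * (`|u - x| * `|u - x| ^+ k) =
  (`|L| * `|u - x|) * (`|C j| * `|u - x| ^+ k) by rewrite mulrACA.
apply: ler_pM => //.
  have [_ /(_ j)[_ H]] := Hpsi _ (Dw _ c01).
  by rewrite (le_trans (H _))// ler_wpM2r// ler_norm.
apply: le_trans (HC j _ _ Bx (Dw _ c01)) _.
have /andP[c0 c1] := c01.
rewrite [x + _]addrC addrK normrZ ger0_norm//.
apply: (@le_trans _ _ (`|C j| * (c * `|u - x|) ^+ k)).
  by rewrite ler_wpM2r ?ler_norm// exprn_ge0// mulr_ge0.
by rewrite ler_wpM2l// lerXn2r ?nnegrE ?mulr_ge0// ler_piMl.
Qed.
End Charts.

Section FlatDecomposition.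
Variables (R : realType).

Lemma compact_image (T S : topologicalType) (A : set T) (f : T -> S) :
  (forall x, A x -> {for x, continuous f}) -> compact A -> compact (f @` A).
Proof.
move=> cf; apply: continuous_compact; apply: continuous_in_subspaceT => x.
by rewrite inE; exact: cf.
Qed.

Lemma norm_delta_le n (i : 'I_n) : `|delta_mx 0 i : 'rV[R]_n| <= 1.
Proof.
apply: rv_norm_le => // j; rewrite mxE eqxx /=.
by case: eqP => _; rewrite ?normr1 ?normr0 ?ler01.
Qed.

Lemma chart_comp n q p (U : set 'rV[R]_n) (D : set 'rV[R]_q)
    (iota : 'rV[R]_q -> 'rV[R]_n) (psi : 'rV[R]_p -> 'rV[R]_q) u0 d L L' :
  (forall u, D u -> U (iota u) /\ forall j,
    differentiable (fun w => iota w 0 j : R^o) u /\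
    forall v, `|dd (fun w => iota w 0 j) u v| <= L * `|v|) ->
  chart D psi u0 d L' ->
  chart U (fun u => iota (psi u)) u0 d (\sum_(i < q) `|L'| * `|L|).
Proof.
move=> Hiota Hpsi u Du; have [Dpsi dpsi] := Hpsi _ Du.
have [Ui di] := Hiota _ Dpsi; split => // j.
have [dij bij] := di j.
have [dcomp E] := dd_comp (fun i => (dpsi i).1) dij.
split=> // v; rewrite E (le_trans (ler_norm_sum _ _ _))// mulr_suml.
apply: ler_sum => i _; rewrite normrM mulrAC; apply: ler_pM => //.
  by rewrite (le_trans ((dpsi i).2 v))// ler_wpM2r// ler_norm.
rewrite (le_trans (bij _))// (@le_trans _ _ (`|L| * `|delta_mx 0 i : 'rV[R]_q|))//.
  by rewrite ler_wpM2r// ler_norm.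
by rewrite ler_piMr// norm_delta_le.
Qed.

Lemma continuous_del_coord n (l : 'I_n.+1) : continuous (@del_coord R n l).
Proof.
move=> x; apply: continuous_row => j.
rewrite (_ : (fun u => _) = (fun u : 'rV[R]_n.+1 => u 0 (lift l j) : R^o)).
  exact: coord_continuous.
by apply/funext => u; rewrite mxE.
Qed.

(** The implicit chart in the form used for dimension induction: near [x0], the compact set [A]
    becomes the image of its own projection [A'], which is compact in one dimension less. *)
Lemma implicit_compact n (l : 'I_n.+1) (k : nat) (U A : set 'rV[R]_n.+1)
    (f : 'rV[R]_n.+1 -> R) x0 :
  open U -> class_C k.+1 U (f : _ -> R^o) -> compact A -> U x0 -> f x0 = 0 ->
  (forall x, A x -> f x = 0) -> dd f x0 (delta_mx 0 l) != 0 ->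
  exists (D A' : set 'rV[R]_n) (iota : 'rV[R]_n -> 'rV[R]_n.+1) (L eps : R),
    [/\ [/\ open D, compact A', A' `<=` D & 0 < eps],
      forall u, D u -> U (iota u) /\ forall j,
        differentiable (fun w => iota w 0 j : R^o) u /\
        forall v, `|dd (fun w => iota w 0 j) u v| <= L * `|v|,
      forall u, D u -> f (iota u) = 0,
      forall j, class_C k.+1 D (fun u => iota u 0 j : R^o) &
      A `&` cball x0 eps = iota @` A'].
Proof.
move=> oU Hf cA Ux0 fx0 fA ne0.
have [d [L [eps [iota [[d0 eps0] H1 H2 H3 H4]]]]] := implicit_chart oU Hf Ux0 fx0 ne0.
exists (nball (del_coord l x0) d), (del_coord l @` (A `&` cball x0 eps)), iota, L, eps.
split=> //.
- split=> //; first exact: open_nball.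
    apply: compact_image; first by move=> x _; exact: continuous_del_coord.
    by apply: compact_closedI => //; exact: closed_cball.
  by move=> _ [x [Ax xe] <-]; exact: (H4 x xe (fA _ Ax)).1.
- move=> u Du; split; first exact: (H1 u Du).1.
  by move=> j; split; [exact: (H2 j).1|move=> v; exact: H3].
- by move=> u Du; exact: (H1 u Du).2.
- apply/seteqP; split=> x.
    move=> [Ax xe]; exists (del_coord l x); first by exists x.
    exact: (H4 x xe (fA _ Ax)).2.
  move=> [_ [y [Ay ye] <-] <-].
  by rewrite (H4 y ye (fA _ Ay)).2; split.
Qed.

(* The points of [A] where some [F i] has a nonzero derivative are locally covered by
   graphs (induction on [n]); where all derivatives vanish, these are functions of
   class [C^(k-1)] vanishing on [A], and flatness is integrated (induction on [k]).
   Quantifying over [I] expresses the countable decomposition of [A]. *)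
Lemma flat_decomposition (k n : nat) (U : set 'rV[R]_n) (J : finType)
    (F : J -> 'rV[R]_n -> R) (A : set 'rV[R]_n) (I : set 'rV[R]_n -> Prop) :
  open U -> compact A -> A `<=` U -> sigma_ideal I ->
  (forall i, class_C k U (F i : _ -> R^o)) ->
  (forall i x, A x -> F i x = 0) ->
  (forall q (psi : 'rV[R]_q -> 'rV[R]_n) u0 d L (B : set 'rV[R]_q),
    (q <= n)%N -> 0 < d -> chart U psi u0 d L -> compact B -> B `<=` nball u0 d ->
    (forall x, B x -> A (psi x)) ->
    (forall i, exists C, forall x u, B x -> nball u0 d u ->
      `|F i (psi u)| <= C * `|u - x| ^+ k) -> I (psi @` B)) ->
  I A.
Proof.
elim: k n U J F A I => [|k IHk] n.
  (* Flatness of order 0 is boundedness, which holds locally by continuity; the identity serves as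
     chart. *)
  move=> U J F A I oU cA AU sI HF _ H.
  apply: compact_local => // x0 Ax0.
  have Ux0 := AU _ Ax0.
  have : \forall y \near x0, U y /\ forall i, `|F i y| <= `|F i x0| + 1.
    have near1 (a b : R) : `|a - b| <= 1 -> `|b| <= `|a| + 1.
      by rewrite -lerBlDl distrC; apply: le_trans; exact: lerB_dist.
    have N1 : \forall y \near x0, U y by exact: open_nbhs_nbhs.
    have N2 : \forall y \near x0, forall i, `|F i y| <= `|F i x0| + 1.
      apply: near_forall => i; have /cvgrPdist_le/(_ _ ltr01) := HF i x0 Ux0.
      by apply: filterS => x; exact: near1.
    by near=> y; split; near: y.
  move=> /nbhs_ballP[d d0 Hd].
  have {}Hd y : nball x0 d y -> U y /\ forall i, `|F i y| <= `|F i x0| + 1.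
    by rewrite /nball /= => yd; apply: Hd; rewrite -ball_normE /= distrC.
  exists (d / 2); first by rewrite divr_gt0.
  rewrite (_ : A `&` _ = id @` (A `&` cball x0 (d / 2))); last by rewrite image_id.
  apply: (H n id x0 d 1) => //.
  - move=> u Du; split; first exact: (Hd _ Du).1.
    move=> j; split; first exact: (dd_coord j u).1.
    by move=> v; rewrite (dd_coord j u).2 mul1r rv_norm_coord.
  - by apply: compact_closedI => //; exact: closed_cball.
  - move=> x [_ xd]; apply: le_lt_trans xd _.
    by rewrite ltr_pdivrMr// ltr_pMr// ltr1n.
  - by move=> x [].
  - move=> i; exists (`|F i x0| + 1) => x u _ Du; rewrite expr0 mulr1.
    exact: (Hd _ Du).2.
(* When all partial derivatives vanish on [A], the induction hypothesis for [k] is applied to them,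
   and [chart_flat] raises the order by one. *)
have flat m U (J : finType) (F : J -> 'rV[R]_m -> R) A I : open U -> compact A ->
  A `<=` U -> sigma_ideal I -> (forall i, class_C k.+1 U (F i : _ -> R^o)) ->
  (forall i x, A x -> F i x = 0) ->
  (forall i l x, A x -> dd (F i) x (delta_mx 0 l) = 0) ->
  (forall q (psi : 'rV[R]_q -> 'rV[R]_m) u0 d L (B : set 'rV[R]_q),
    (q <= m)%N -> 0 < d -> chart U psi u0 d L -> compact B -> B `<=` nball u0 d ->
    (forall x, B x -> A (psi x)) ->
    (forall i, exists C, forall x u, B x -> nball u0 d u ->
      `|F i (psi u)| <= C * `|u - x| ^+ k.+1) -> I (psi @` B)) -> I A.
  move=> oU cA AU sI HF FA dFA H.
  have Hdd i := class_C_dd (HF i).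
  apply: (IHk m U (J * 'I_m)%type (fun il x => dd (F il.1) x (delta_mx 0 il.2)) A) => //.
  - by move=> [i l]; exact: (Hdd i).2.
  - by move=> [i l] x; exact: dFA.
  move=> q psi u0 d L B qm d0 Hpsi cB BD BA HB; apply: (H q psi u0 d L B) => // i.
  have [C HC] := chart_flat Hpsi BD (Hdd i).1 (fun l => HB (i, l)).
  exists C => x u Bx Du; have := HC x u Bx Du.
  by rewrite (FA i (psi x)) ?subr0//; exact: BA.
have step m U (J : finType) (F : J -> 'rV[R]_m -> R) A I : open U -> compact A ->
  A `<=` U -> sigma_ideal I -> (forall i, class_C k.+1 U (F i : _ -> R^o)) ->
  (forall i x, A x -> F i x = 0) ->
  (forall q (psi : 'rV[R]_q -> 'rV[R]_m) u0 d L (B : set 'rV[R]_q),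
    (q <= m)%N -> 0 < d -> chart U psi u0 d L -> compact B -> B `<=` nball u0 d ->
    (forall x, B x -> A (psi x)) ->
    (forall i, exists C, forall x u, B x -> nball u0 d u ->
      `|F i (psi u)| <= C * `|u - x| ^+ k.+1) -> I (psi @` B)) ->
  (forall i l x0 A', A' `<=` A -> compact A' -> A' x0 ->
    dd (F i) x0 (delta_mx 0 l) != 0 ->
    exists2 e : R, 0 < e & I (A' `&` cball x0 e)) -> I A.
  move=> oU cA AU sI HF FA H Hne.
  have Hdd i := class_C_dd (HF i).
  have cont i l x : A x -> {for x, continuous (fun x => dd (F i) x (delta_mx 0 l) : R^o)}.
    by move=> /AU; exact: class_C_continuous ((Hdd i).2 _).
  (* All partial derivatives in one vector, so that their common zeros in [A] form a single compact
     set. *)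
  pose G x : 'rV[R]_#|{: J * 'I_m}| :=
    \row_t dd (F (enum_val t).1) x (delta_mx 0 (enum_val t).2).
  have contG x : A x -> {for x, continuous G}.
    move=> Ax; apply: continuous_row => t.
    rewrite (_ : (fun u => _) = (fun u =>
      dd (F (enum_val t).1) u (delta_mx 0 (enum_val t).2) : R^o)).
      exact: cont.
    by apply/funext => u; rewrite mxE.
  pose A0 := A `&` G @^-1` [set 0].
  have cA0 : compact A0.
    apply: compact_preimage => //; apply: compact_closed; last exact: compact_set1.
    exact: norm_hausdorff.
  have IA0 : I A0.
    apply: (flat m U J F A0 I) => //.
    - by move=> x [/AU].
    - by move=> i x [Ax _]; exact: FA.
    - move=> i l x [_ /= /rowP/(_ (enum_rank (i, l)))].
      by rewrite !mxE enum_rankK.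
    - move=> q psi u0 d L B qm d0 Hpsi cB BD BA HB.
      by apply: (H q psi u0 d L B) => // x /BA[].
  pose A1 (t : J * 'I_m * nat) := A `&`
    (fun x => `|dd (F t.1.1) x (delta_mx 0 t.1.2)|) @^-1` [set r : R | t.2.+1%:R^-1 <= r].
  have cA1 t : compact (A1 t).
    apply: compact_preimage ; [exact: cA| |exact: closed_ge].
    by move=> x Ax; exact: (cvg_norm (cont t.1.1 t.1.2 x Ax)).
  have IA1 t : I (A1 t).
    apply: compact_local => // x0 A1x0; apply: (Hne t.1.1 t.1.2) => //.
      by move=> x [].
    rewrite -normr_gt0; apply: lt_le_trans A1x0.2.
    by rewrite invr_gt0 ltr0n.
  apply: (sI (option (J * 'I_m * nat)) A (fun o => if o is Some t then A1 t else A0)).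
  - by case.
  - by case.
  move=> x Ax; have [Gx|/eqP] := eqVneq (G x) 0; first by exists None.
  move=> /eqP Gx; have [t Gt] : exists t, G x 0 t != 0.
    apply: contrapT => /forallNP N; move/eqP: Gx; apply.
    by apply/rowP => t; rewrite [RHS]mxE; apply/eqP/negPn/negP; exact: N.
  have : 0 < `|G x 0 t| by rewrite normr_gt0.
  move=> /ltr_add_invr[p]; rewrite add0r => /ltW Hp.
  by exists (Some (enum_val t, p)) => //; split=> //; move: Hp; rewrite mxE.
elim: n => [|n IHn] U J F A I oU cA AU sI HF FA H.
  by apply: (step 0%N U J F A I) => // i [].
apply: (step n.+1 U J F A I) => // i l x0 A' A'A cA' A'x0 ne0.
have Ax0 := A'A _ A'x0.
have [D [As [iota [L [eps [[oD cAs AsD eps0] H1 H2 H3 H4]]]]]] :=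
  implicit_compact oU (HF i) cA' (AU _ Ax0) (FA _ _ Ax0) (fun x A'x => FA i x (A'A _ A'x)) ne0.
exists eps => //; rewrite H4.
have ci x : As x -> {for x, continuous iota}.
  move=> /AsD Dx; apply: continuous_row => j.
  exact: class_C_continuous (H3 j) Dx.
have iotaA x : As x -> A (iota x).
  move=> Asx; apply: A'A; suff [] : (A' `&` cball x0 eps) (iota x) by [].
  by rewrite H4; exists x.
(* The pullback of [I] along [iota]. The intersection with [As] is there because [iota] is
   controlled on [D] only, and its images must be compact. *)
pose I' B := I (iota @` (B `&` As)).
have cI B : compact B -> compact (B `&` As).
  by move=> cB; apply: compact_closedI => //; apply: compact_closed => //; exact: norm_hausdorff.
have : I' As.
  apply: (IHn D J (fun i x => F i (iota x)) As I') => //.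
  - move=> J' B Bs cBs IBs Bsub.
    apply: (sI J' _ (fun j => iota @` (Bs j `&` As))) => //.
      by move=> j; apply: compact_image; [move=> x [_]; exact: ci|exact: cI].
    by move=> _ [x [/Bsub[j _ Bjx] Asx] <-]; exists j => //; exists x.
  - by move=> j; apply: class_C_comp oD _ H3 (HF j) => u /H1[].
  - by move=> j x Asx; apply: FA; exact: iotaA.
  move=> q psi u0 d L' B qn d0 Hpsi cB BD BA HB.
  rewrite /I' (_ : iota @` _ = (fun u => iota (psi u)) @` B).
    apply: (H q _ u0 d _ B _ d0 (chart_comp H1 Hpsi)) => //; first exact: leqW.
    by move=> x Bx; apply: iotaA; exact: BA.
  apply/seteqP; split=> [_ [_ [[x Bx <-] _] <-]|_ [x Bx <-]]; first by exists x.
  by exists (psi x) => //; split; [exists x|exact: BA].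
by rewrite /I' setIid.
Unshelve. all: by end_near. Qed.
End FlatDecomposition.

(** * Sard's theorem *)

(** Baire's theorem is applied in spaces of row vectors, which have to be recognized as complete. *)
HB.instance Definition _ (R : realType) m n := Complete.on 'M[R]_(m, n).

(** * Images with nonempty interior: slicing and Baire category *)

Section Fat.
Variables (R : realType) (m : nat).

(* The projection to the coordinates in [S] of the image of [A] under [phi] has
   nonempty interior. *)
Definition fat n (S : {set 'I_m}) (phi : 'I_m -> 'rV[R]_n -> R) (A : set 'rV[R]_n) :=
  exists (y : 'rV[R]_m) (e : R), 0 < e /\ forall y', nball y e y' ->
    exists2 x, A x & forall i, i \in S -> phi i x = y' 0 i.

Lemma fatS n S (phi : 'I_m -> 'rV[R]_n -> R) (A B : set 'rV[R]_n) :
  A `<=` B -> fat S phi A -> fat S phi B.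
Proof.
move=> AB [y [e [e0 H]]]; exists y, e; split=> // y' /H[x Ax E].
by exists x => //; exact: AB.
Qed.

Lemma fat_image n q S (phi : 'I_m -> 'rV[R]_n -> R) (psi : 'rV[R]_q -> 'rV[R]_n) B :
  fat S phi (psi @` B) -> fat S (fun i x => phi i (psi x)) B.
Proof.
move=> [y [e [e0 H]]]; exists y, e; split=> // y' /H[_ [x Bx <-] E].
by exists x.
Qed.

(** The slice at the centre, [t = y 0 j], works with the same radius: resetting the [j]-th
    coordinate of a target to [y 0 j] does not leave the ball, the norm being the maximum norm. *)
Lemma fat_slice n (S : {set 'I_m}) (phi : 'I_m -> 'rV[R]_n -> R) (A : set 'rV[R]_n) j :
  j \in S -> fat S phi A ->
  exists t, fat (S :\ j) phi (A `&` [set x | phi j x = t]).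
Proof.
move=> jS [y [e [e0 H]]]; exists (y 0 j), y, e; split=> // y' y'e.
pose y'' : 'rV[R]_m := \row_i if i == j then y 0 j else y' 0 i.
have [|x Ax E] := H y''.
  apply: rv_norm_lt => // i; rewrite !mxE; case: eqP => [->|_].
    by rewrite subrr normr0.
  by have := rv_norm_coord (y' - y) i; rewrite !mxE => /le_lt_trans; exact.
exists x; first by split=> //=; rewrite E// mxE eqxx.
by move=> i; rewrite !inE => /andP[ij iS]; rewrite E// mxE (negPf ij).
Qed.

(** If no piece were fat, the closed sets of targets that they reach would have empty interior, and
    Baire's theorem would give a target in the ball reached by none of them. *)
Lemma fat_baire n (S : {set 'I_m}) (phi : 'I_m -> 'rV[R]_n -> R) (K A : set 'rV[R]_n)
    (J : countType) (As : J -> set 'rV[R]_n) :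
  compact K -> (forall i x, K x -> {for x, continuous (phi i : _ -> R^o)}) ->
  (forall j, compact (As j)) -> A `<=` \bigcup_j As j ->
  fat S phi (A `&` K) -> exists j, fat S phi (As j `&` K).
Proof.
move=> cK cphi cAs Acov [y [e [e0 H]]].
(* Coordinates outside [S] are set to 0 in source and target alike, so that fatness becomes an
   interior in R^m of the closed sets [G k], which are indexed by naturals through [pickle]. *)
pose pr (y : 'rV[R]_m) : 'rV[R]_m := \row_i if i \in S then y 0 i else 0.
pose g (x : 'rV[R]_n) : 'rV[R]_m := \row_i if i \in S then phi i x else 0.
pose G (k : nat) := if unpickle k is Some j then
  pr @^-1` (g @` (As j `&` K)) else set0.
have clG k : closed (G k).
  rewrite /G; case: (unpickle k) => [j|]; last exact: closed0.
  apply: preimage_closed.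
    move=> z _; apply: continuous_row => i.
    case iS : (i \in S).
      rewrite (_ : (fun u => _) = (fun u : 'rV[R]_m => u 0 i : R^o)).
        exact: coord_continuous.
      by apply/funext => u; rewrite mxE iS.
    rewrite (_ : (fun u => _) = (fun u : 'rV[R]_m => 0 : R^o)).
      exact: cst_continuous.
    by apply/funext => u; rewrite mxE iS.
  apply: compact_closed; first exact: norm_hausdorff.
  apply: compact_image.
    move=> x [_ Kx]; apply: continuous_row => i.
    case iS : (i \in S).
      rewrite (_ : (fun u => _) = (phi i : _ -> R^o)); first exact: cphi.
      by apply/funext => u; rewrite mxE iS.
    rewrite (_ : (fun u => _) = (fun u : 'rV[R]_n => 0 : R^o)).
      exact: cst_continuous.
    by apply/funext => u; rewrite mxE iS.
  apply: compact_closedI => //; apply: compact_closed => //; exact: norm_hausdorff.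
apply: contrapT => /forallNP nofat.
have dG : dense (\bigcap_k ~` G k).
  apply: Baire => k; split; first exact: closed_openC.
  move=> O [z Oz] oO; apply: contrapT => /set0P/negP; rewrite negbK => /eqP OG.
  have sub w : O w -> G k w.
    by move=> Ow; apply: contrapT => nG; have : (O `&` ~` G k) w by []; rewrite OG.
  have := sub _ Oz; move: sub; rewrite /G; case: (unpickle k) => // j sub _.
  apply: (nofat j); move: (open_nbhs_nbhs (conj oO Oz)) => /nbhs_ballP[r r0 Hr].
  exists z, r; split=> // w wr.
  have [|x Ax gx] := sub w.
    by apply: Hr; rewrite -ball_normE /= distrC.
  by exists x => // i iS; move/rowP/(_ i) : gx; rewrite !mxE iS.
have [||y' [y'e nG]] := dG (nball y e).
- by exists y; rewrite /nball /= subrr normr0.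
- exact: open_nball.
have [x [Ax Kx] E] := H _ y'e; have [j _ Ajx] := Acov _ Ax.
apply: (nG (pickle j)) => //; rewrite /G pickleK; exists x => //.
by apply/rowP => i; rewrite !mxE; case: ifP => // /E.
Qed.
End Fat.

(** * Flat maps have thin images: counting grid cells *)

Section Counting.
Variables (R : realType) (m : nat).

Lemma truncn_eq_dist (a b : R) : 0 <= a -> 0 <= b ->
  Num.truncn a = Num.truncn b -> `|a - b| < 1.
Proof.
move=> /truncn_itv/andP[a1 a2] /truncn_itv/andP[b1 b2] ab.
rewrite ab in a1 a2; rewrite -natr1 in a2 b2.
by rewrite ltr_norml; apply/andP; split; lra.
Qed.

Lemma nat_dist_lt1 (a b : nat) : `|a%:R - b%:R : R| < 1 -> a = b.
Proof.
wlog ab : a b / (a <= b)%N => [H|].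
  by have [/H//|/ltnW/H E] := leqP a b; rewrite distrC => /E.
rewrite distrC -natrB// normr_nat (ltr_nat R _ 1) ltnS leqn0 subn_eq0 => ba.
by apply/eqP; rewrite eqn_leq ab.
Qed.

(** The ball is a cube of side [2 * d]. Each coordinate is rescaled to [0, M) and truncated; equal
    truncations mean rescaled coordinates less than 1 apart. *)
Lemma grid_cell q (M : nat) (u0 : 'rV[R]_q) d : 0 < d -> (0 < M)%N ->
  exists cell : 'rV[R]_q -> {ffun 'I_q -> 'I_M}, forall x u,
    nball u0 d x -> nball u0 d u -> cell x = cell u -> `|u - x| <= 2 * d / M%:R.
Proof.
move=> d0; case: M => // M _.
pose a (x : 'rV[R]_q) l := M.+1%:R * ((x 0 l - u0 0 l + d) / (2 * d)) : R.
exists (fun x => [ffun l => inord (Num.truncn (a x l))]) => x u xd ud E.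
have dd0 : 0 < 2 * d by rewrite mulr_gt0.
have bnd y l : nball u0 d y -> 0 <= a y l < M.+1%:R.
  rewrite /nball /= => yd; have := rv_norm_coord (y - u0) l; rewrite !mxE.
  move=> /le_lt_trans/(_ yd); rewrite ltr_norml => /andP[h1 h2].
  rewrite mulr_ge0 ?divr_ge0 ?(ltW dd0)//=; last by rewrite -(opprK d) subr_ge0 ltW.
  rewrite gtr_pMr ?ltr0n// ltr_pdivrMr// mul1r [2 * d]mulrDl !mul1r.
  by rewrite ltrD2r.
have tr y l : nball u0 d y -> (Num.truncn (a y l) < M.+1)%N.
  move=> /(bnd y l)/andP[h1 h2]; have /andP[h3 _] := truncn_itv h1.
  by rewrite -(ltr_nat R) (le_lt_trans h3).
apply: rv_norm_le => [|l]; first by rewrite divr_ge0// ltW.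
move/ffunP/(_ l): E; rewrite !ffunE => /(congr1 (@nat_of_ord _)); rewrite !inordK ?tr// => E.
have /andP[ax _] := bnd _ l xd; have /andP[au _] := bnd _ l ud.
have := truncn_eq_dist au ax (esym E).
rewrite /a -mulrBr -mulrBl opprD addrACA subrr addr0 opprB addrA subrK.
rewrite normrM normr_nat normrM normfV [`|2 * d|]gtr0_norm// mulrA.
rewrite ltr_pdivrMr// mul1r => H.
by rewrite !mxE ler_pdivlMr ?ltr0n// mulrC ltW.
Qed.

(** Pigeonhole: a fat image would reach P^|S| grid targets spaced by e/P. Two preimages in one of
    the M^q cells of the source have values less than e/P apart, hence equal targets, so P^|S| <=
    M^q, which the choice of M and P excludes. *)
Lemma thin_of_flat q r (S : {set 'I_m}) (g : 'I_m -> 'rV[R]_q -> R)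
    (u0 : 'rV[R]_q) d (B : set 'rV[R]_q) :
  0 < d -> B `<=` nball u0 d -> (0 < r)%N -> (q < r * #|S|)%N ->
  (forall i, i \in S -> exists C, forall x u, B x -> B u ->
    `|g i u - g i x| <= C * `|u - x| ^+ r) ->
  ~ fat S g B.
Proof.
move=> d0 BD r0 qr Hg [y [e [e0 Hfat]]].
have /choice[C' HC'] : forall i, exists C, i \in S -> forall x u, B x -> B u ->
    `|g i u - g i x| <= C * `|u - x| ^+ r.
  by move=> i; case iS : (i \in S); [have [C HC] := Hg i iS; exists C|exists 0].
pose C := 1 + \sum_i `|C' i|.
have C0 : 0 < C by rewrite ltr_pwDl// sumr_ge0.
have HC i x u : i \in S -> B x -> B u -> `|g i u - g i x| <= C * `|u - x| ^+ r.
  move=> iS Bx Bu; apply: le_trans (HC' i iS x u Bx Bu) _.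
  rewrite ler_wpM2r ?exprn_ge0// (le_trans (ler_norm _))// /C (bigD1 i)//= addrCA.
  by rewrite lerDl addr_ge0// sumr_ge0.
(* [a] absorbs the constants: with M^r = P a, it gives C (2d/M)^r < e/P. As [s] exceeds a^q, M^q =
   a^q s^q < s^(q+1) <= s^(r|S|) <= P^|S|. *)
pose a := (Num.truncn (C * (2 * d) ^+ r / e)).+1.
have ha : C * (2 * d) ^+ r / a%:R < e.
  rewrite ltr_pdivrMr ?ltr0n// [e * _]mulrC -ltr_pdivrMr//.
  have h : 0 <= C * (2 * d) ^+ r / e.
    by rewrite divr_ge0 ?mulr_ge0 ?exprn_ge0 ?mulr_ge0// ltW.
  by have /andP[] := truncn_itv h.
pose s := (a ^ q).+1.
pose M := (a * s)%N.
pose P := (a ^ r.-1 * s ^ r)%N.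
have P0 : (0 < P)%N by rewrite muln_gt0 !expn_gt0.
have M0 : (0 < M)%N by rewrite muln_gt0.
have [cell Hcell] := @grid_cell q M u0 d d0 M0.
pose T := {ffun {i : 'I_m | i \in S} -> 'I_P}.
pose yk (k : T) : 'rV[R]_m := \row_i
  (y 0 i + (if insub i is Some i' then e * (k i')%:R / P%:R else 0)).
have Hyk k : exists x, B x /\ forall i, i \in S -> g i x = yk k 0 i.
  have [|x Bx E] := Hfat (yk k); last by exists x.
  apply: rv_norm_lt => // i; rewrite !mxE addrC addKr.
  case: insubP => [i' _ _|_]; last by rewrite normr0.
  rewrite ger0_norm; last by rewrite divr_ge0// mulr_ge0// ltW.
  by rewrite ltr_pdivrMr ?ltr0n// ltr_pM2l// ltr_nat.
have /choice[xk Hxk] := Hyk.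
have inj : injective (fun k : T => cell (xk k)).
  move=> k k' E; have [Bk Ek] := Hxk k; have [Bk' Ek'] := Hxk k'.
  have H := Hcell _ _ (BD _ Bk) (BD _ Bk') E.
  apply/ffunP => i'; apply/val_inj => /=.
  have iS := valP i'.
  have := HC _ _ _ iS Bk Bk'; rewrite Ek// Ek'// !mxE valK.
  rewrite opprD addrACA subrr add0r -mulrBl -mulrBr => H1.
  have H2 : `|e * ((k' i')%:R - (k i')%:R) / P%:R| <= C * (2 * d / M%:R) ^+ r.
    apply: le_trans H1 _; rewrite ler_wpM2l ?(ltW C0)// lerXn2r ?nnegrE//.
    by rewrite divr_ge0// mulr_ge0// ltW.
  have PM : (M ^ r = P * a)%N.
    by rewrite /M /P expnMn -{1}(prednK r0) expnSr mulnAC.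
  have H3 : C * (2 * d / M%:R) ^+ r < e / P%:R.
    rewrite expr_div_n -natrX PM natrM invfM mulrA mulrA mulrAC.
    by rewrite ltr_pM2r// invr_gt0 ltr0n.
  have := le_lt_trans H2 H3.
  rewrite !normrM normfV normr_nat ltr_pM2r ?invr_gt0 ?ltr0n//.
  rewrite gtr0_norm// gtr_pMr// => H4.
  by rewrite (nat_dist_lt1 H4).
have := leq_card _ inj.
rewrite !card_ffun !card_ord card_sig.
apply/negP; rewrite -ltnNge expnMn.
have s0 : (0 < s)%N by [].
apply: (@leq_trans (s ^ q.+1)); first by rewrite expnS ltn_pmul2r ?expn_gt0.
apply: (@leq_trans (s ^ (r * #|S|))); first by apply: leq_pexp2l.
by rewrite /P expnMn -!expnM leq_pmull// expn_gt0.
Qed.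
End Counting.

Section Sard.
Variables (R : realType) (m : nat).

Lemma dd_addc (V : normedModType R) (f : V -> R) t x :
  differentiable (f : V -> R^o) x -> dd (fun y => f y + t) x = dd f x.
Proof.
move=> df; apply: (dd_of_eps (f := fun y => f y + t) _ _ _).2.
- by move=> a u v; rewrite ddD ddZ.
- by rewrite ddE; exact: diff_continuous.
- move=> e e0; have := dd_eps df e0; apply: filterS => h.
  by rewrite opprD addrACA subrr addr0.
Qed.

Lemma dd_near_cst (V : normedModType R) (f : V -> R) (U : set V) t x :
  open U -> U x -> (forall y, U y -> f y = t) -> dd f x = fun=> 0.
Proof.
move=> oU Ux fU.
have E : \forall y \near x, (cst t : V -> R^o) y = f y.
  have : nbhs x U by exact: open_nbhs_nbhs.
  by apply: filterS => y /fU.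
have [_] := diff_near_eq E (differentiable_cst _ _).
by rewrite diff_cst ddE => ->.
Qed.

Lemma sigma_ideal_thin n (S : {set 'I_m}) (phi : 'I_m -> 'rV[R]_n -> R) K :
  compact K -> (forall i x, K x -> {for x, continuous (phi i : _ -> R^o)}) ->
  sigma_ideal (fun A => ~ fat S phi (A `&` K)).
Proof.
move=> cK cphi J A As cAs nfat Acov fA.
have [j] := fat_baire cK cphi cAs Acov fA.
exact: nfat.
Qed.

(** Rank deficiency of the components indexed by [S], in dual form: a nonzero covector kills the
    image of the differential. The same covector can be used on a level set of one component. *)
Definition dependent_at n (S : {set 'I_m}) (phi : 'I_m -> 'rV[R]_n -> R) x :=
  exists2 lam : 'I_m -> R, exists2 i, i \in S & lam i != 0 &
    forall v, \sum_(i in S) lam i * dd (phi i) x v = 0.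

(** The decomposition is applied to the partial derivatives, of class C^r, and integrated once, so
    that the components vary by O(|u - x|^(r+1)) on pieces of dimension q <= n; this is what the
    grid count needs. *)
Lemma sard_flat n r U (S : {set 'I_m}) (phi : 'I_m -> 'rV[R]_n -> R) A :
  open U -> compact A -> A `<=` U ->
  (forall i, class_C r.+1 U (phi i : _ -> R^o)) -> (n < r.+1 * #|S|)%N ->
  (forall i l x, i \in S -> A x -> dd (phi i) x (delta_mx 0 l) = 0) ->
  ~ fat S phi A.
Proof.
move=> oU cA AU Hphi nr dA.
have Hdd i := class_C_dd (Hphi i).
have cphi i x : A x -> {for x, continuous (phi i : _ -> R^o)}.
  by move=> /AU; exact: class_C_continuous (Hphi i).
rewrite -[X in fat _ _ X]setIid.
apply: (@flat_decomposition R r n U ({i : 'I_m | i \in S} * 'I_n)%type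
  (fun il x => dd (phi (val il.1)) x (delta_mx 0 il.2)) A
  (fun B => ~ fat S phi (B `&` A))) => //.
- exact: sigma_ideal_thin.
- by move=> [i l] /=; exact: (Hdd _).2.
- by move=> [i l] x Ax /=; apply: dA => //; exact: (valP i).
move=> q psi u0 d L B qn d0 Hpsi cB BD BA HB fB.
have {}fB : fat S phi (psi @` B) by apply: fatS fB => x [].
apply: (thin_of_flat d0 BD (ltn0Sn r) (leq_ltn_trans qn nr) _ (fat_image fB)).
move=> i iS.
have [C HC] := chart_flat Hpsi BD (Hdd i).1 (fun l => HB (exist _ i iS, l)).
by exists C => x u Bx Bu; apply: HC => //; exact: BD.
Qed.

(** Induction on [n]: where some partial derivative of a component is nonzero, a level set of that
    component is a graph of dimension one less, and one index of [S] is dropped; where all vanish,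
    [sard_flat] concludes. *)
Lemma sard_thin n r U (S : {set 'I_m}) (phi : 'I_m -> 'rV[R]_n -> R) A :
  open U -> compact A -> A `<=` U ->
  (forall i, class_C r.+1 U (phi i : _ -> R^o)) -> (n.+1 <= r + #|S|)%N ->
  (forall x, A x -> dependent_at S phi x) ->
  ~ fat S phi A.
Proof.
(* By Baire, a fat compact set has a fat compact part on which either one partial derivative is
   bounded away from 0, or all of them vanish; the latter contradicts [sard_flat]. *)
have pieces q V (T : {set 'I_m}) (g : 'I_m -> 'rV[R]_q -> R) B :
    open V -> compact B -> B `<=` V ->
    (forall i, class_C r.+1 V (g i : _ -> R^o)) -> (q.+1 <= r + #|T|)%N ->
    (forall x, B x -> dependent_at T g x) -> fat T g B ->
    exists i l (B' : set 'rV[R]_q), [/\ i \in T, compact B', B' `<=` B,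
      fat T g B' & forall x, B' x -> dd (g i) x (delta_mx 0 l) != 0].
  move=> oV cB BV Hg qr dep fB.
  have Hdd i := class_C_dd (Hg i).
  have cg i x : B x -> {for x, continuous (g i : _ -> R^o)}.
    by move=> /BV; exact: class_C_continuous (Hg i).
  have cont i l x : B x -> {for x, continuous (fun x => dd (g i) x (delta_mx 0 l) : R^o)}.
    by move=> /BV; exact: class_C_continuous ((Hdd i).2 _).
  pose G x : 'rV[R]_#|{: 'I_m * 'I_q}| := \row_t
    if (enum_val t).1 \in T then dd (g (enum_val t).1) x (delta_mx 0 (enum_val t).2) else 0.
  pose B0 := B `&` G @^-1` [set 0].
  pose B1 (t : 'I_m * 'I_q * nat) := if t.1.1 \in T then B `&`
    (fun x => `|dd (g t.1.1) x (delta_mx 0 t.1.2)|) @^-1` [set s : R | t.2.+1%:R^-1 <= s]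
    else set0.
  have cB0 : compact B0.
    apply: compact_preimage => //; last first.
      by apply: compact_closed; [exact: norm_hausdorff|exact: compact_set1].
    move=> x Bx; apply: continuous_row => t.
    case tT : ((enum_val t).1 \in T).
      rewrite (_ : (fun u => _) = (fun u =>
        dd (g (enum_val t).1) u (delta_mx 0 (enum_val t).2) : R^o)).
        exact: cont.
      by apply/funext => u; rewrite mxE tT.
    rewrite (_ : (fun u => _) = (fun u : 'rV[R]_q => 0 : R^o)).
      exact: cst_continuous.
    by apply/funext => u; rewrite mxE tT.
  have cB1 t : compact (B1 t).
    rewrite /B1; case: ifP => _; last exact: compact0.
    apply: compact_preimage; [exact: cB| |exact: closed_ge].
    by move=> x Bx; exact: (cvg_norm (cont t.1.1 t.1.2 x Bx)).
  have [|||[t|]] := @fat_baire R m q T g B B (option ('I_m * 'I_q * nat))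
      (fun o => if o is Some t then B1 t else B0) cB cg.
  - by case.
  - move=> x Bx; have [Gx|/eqP] := eqVneq (G x) 0; first by exists None.
    move=> /eqP Gx; have [t Gt] : exists t, G x 0 t != 0.
      apply: contrapT => /forallNP N; move/eqP: Gx; apply.
      by apply/rowP => t; rewrite [RHS]mxE; apply/eqP/negPn/negP; exact: N.
    have : 0 < `|G x 0 t| by rewrite normr_gt0.
    move=> /ltr_add_invr[p]; rewrite add0r => /ltW Hp.
    exists (Some (enum_val t, p)) => //; rewrite /B1 /=.
    move: Hp Gt; rewrite mxE; case: ifP => [tT Hp _|_ _]; last by rewrite eqxx.
    by split.
  - by rewrite setIid.
  - move=> fB1; exists t.1.1, t.1.2, (B1 t).
    have tT : t.1.1 \in T.
      apply: contrapT => /negP/negPf tT; case: fB1 => y [e [e0 /(_ y)[]]].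
        by rewrite /nball /= subrr normr0.
      by move=> x []; rewrite /B1 tT.
    split=> //; first by rewrite /B1 tT => x [].
      by apply: fatS fB1 => x [].
    move=> x; rewrite /B1 tT => -[_ /=]; rewrite -normr_gt0; apply: lt_le_trans.
    by rewrite invr_gt0 ltr0n.
  move=> fB0; exfalso.
  have {}fB0 : fat T g B0 by apply: fatS fB0 => x [].
  (* A fat set has a point, and dependence there provides an index in [T]. With [T] nonempty,
     (r+1)|T| >= r + |T| > q. *)
  have T0 : (0 < #|T|)%N.
    case: (fB0) => y [e [e0 /(_ y)[]]]; first by rewrite /nball /= subrr normr0.
    move=> x [/dep[lam [i iT _] _] _] _.
    by apply/card_gt0P; exists i.
  apply: (sard_flat (S := T) (phi := g) oV cB0 _ Hg _ _ fB0).
  - by move=> x [/BV].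
  - by rewrite mulSn; move: T0 qr; case: #|T| => // b _; rewrite mulnS; lia.
  - move=> i l x iT [_ /= /rowP/(_ (enum_rank (i, l)))].
    by rewrite !mxE enum_rankK /= iT.
elim: n U S phi A => [|n IH] U S phi A oU cA AU Hphi nr dep fA.
  (* In dimension 0 there is no direction [l] for a nonzero partial derivative. *)
  by have [i [[l l0] _]] := pieces _ _ _ _ _ oU cA AU Hphi nr dep fA.
have [i [l [B [iS cB BA fB neB]]]] := pieces _ _ _ _ _ oU cA AU Hphi nr dep fA.
have [t ft] := fat_slice iS fB.
have cphi j x : B x -> {for x, continuous (phi j : _ -> R^o)}.
  by move=> /BA/AU; exact: class_C_continuous (Hphi j).
pose K := B `&` [set x | phi i x = t].
have cK : compact K.
  apply: (compact_preimage (Z := [set t]) (g := phi i)) => //.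
  by move=> x; exact: cphi.
have cphiK j x : K x -> {for x, continuous (phi j : _ -> R^o)}.
  by move=> [/cphi].
pose f x := phi i x - t.
have Hf : class_C r.+1 U (f : _ -> R^o).
  exact: class_C_add oU (Hphi i) (class_C_cst _ _ (- t : R^o)).
have diff_phi j x : U x -> differentiable (phi j : _ -> R^o) x.
  exact: (class_C_dd (Hphi j)).1.
have fK x : K x -> f x = 0 by move=> [_ /= E]; rewrite /f E subrr.
apply: (@compact_local R _ (fun B' => ~ fat (S :\ i) phi (B' `&` K)) K) => //.
- exact: sigma_ideal_thin.
- move=> x0 Kx0; have Ux0 : U x0 by apply/AU/BA; case: Kx0.
  have ne0 : dd f x0 (delta_mx 0 l) != 0.
    by rewrite dd_addc; [apply: neB; case: Kx0|exact: diff_phi].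
  have [D [K' [iota [L [eps [[oD cK' K'D eps0] H1 H2 H3 H4]]]]]] :=
    implicit_compact oU Hf cK Ux0 (fK _ Kx0) fK ne0.
  exists eps => //; rewrite H4 => fI.
  have {}fI : fat (S :\ i) phi (iota @` K') by apply: fatS fI => x [].
  apply: (IH D (S :\ i) (fun j x => phi j (iota x)) K' oD cK' K'D _ _ _ (fat_image fI)).
  + by move=> j; apply: class_C_comp oD _ H3 (Hphi j) => u /H1[].
  + by move: nr; rewrite (cardsD1 i S) iS; lia.
  move=> x K'x; have Dx := K'D _ K'x; have [Uy Hi] := H1 _ Dx.
  have By : B (iota x).
    suff [[]] : (K `&` cball x0 eps) (iota x) by [].
    by rewrite H4; exists x.
  have [lam [i0 i0S li0] Hlam] := dep _ (BA _ By).
  have comp j := dd_comp (fun s => (Hi s).1) (diff_phi j _ Uy).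
  exists lam.
    (* The covector keeps a nonzero entry after [i] is dropped: otherwise the relation tested on the
       [l]-th basis vector would make the nonzero partial derivative of [phi i] vanish. *)
    apply: contrapT => N.
    have lam0 j : j \in S -> j != i -> lam j = 0.
      move=> jS ji; apply/eqP/negPn/negP => lj; apply: N; exists j => //.
      by rewrite !inE ji.
    have li : lam i != 0.
      by have [<-//|ne] := eqVneq i0 i; move: li0; rewrite (lam0 i0 i0S ne) eqxx.
    have := Hlam (delta_mx 0 l); rewrite (bigD1 i)//= big1 ?addr0.
      by move/eqP; rewrite mulf_eq0 (negPf li) (negPf (neB _ By)).
    by move=> j /andP[jS ji]; rewrite lam0// mul0r.
  (* [w] is the image of [v] under the differential of [iota]; it is tangent to the level set, so
     the [i]-th term of the relation vanishes at it. *)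
  move=> v; pose w : 'rV[R]_n.+1 := \row_s dd (fun u => iota u 0 s) x v.
  have E j : dd (fun u => phi j (iota u)) x v = dd (phi j) (iota x) w.
    rewrite (comp j).2 dd_row; apply: eq_bigr => s _.
    by rewrite mxE.
  have Ei : dd (phi i) (iota x) w = 0.
    rewrite -E (@dd_near_cst _ _ D t) // => u Du.
    by have /eqP := H2 u Du; rewrite subr_eq0 => /eqP.
  have := Hlam w; rewrite (bigD1 i)//= Ei mulr0 add0r => H.
  rewrite -[RHS]H; apply: eq_big => [j|j _]; last by rewrite E.
  by rewrite !inE andbC.
- by rewrite setIid.
Qed.
End Sard.

(** * Moment maps *)

Section NatExtrema.

Lemma nat_minP (P : set nat) k : P k ->
  P (nat_min P) /\ forall j, P j -> (nat_min P <= j)%N.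
Proof.
move=> Pk; rewrite /nat_min.
apply: (@xgetPex _ 0%N [set k | P k /\ forall j, P j -> (k <= j)%N]).
have ex : exists n, `[< P n >] by exists k; apply/asboolP.
exists (ex_minn ex); case: ex_minnP => n /asboolP Pn H; split=> // j Pj.
by apply: H; apply/asboolP.
Qed.

Lemma nat_max_ge (P : set nat) b k : (forall j, P j -> (j <= b)%N) -> P k ->
  (k <= nat_max P)%N.
Proof.
move=> Pb Pk; rewrite /nat_max.
suff [] : [set k | P k /\ forall j, P j -> (j <= k)%N] (nat_max P).
  by move=> _; exact.
apply: (@xgetPex _ 0%N [set k | P k /\ forall j, P j -> (j <= k)%N]).
have ex : exists n, `[< P n >] by exists k; apply/asboolP.
have ub : forall i, `[< P i >] -> (i <= b)%N by move=> i /asboolP; exact: Pb.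
exists (ex_maxn ex ub); case: ex_maxnP => n /asboolP Pn H; split=> // j Pj.
by apply: H; apply/asboolP.
Qed.
End NatExtrema.

Section LinearMaps.
Variables (R : realType).

Lemma rV_linear_continuous n (W : normedModType R) (L : 'rV[R]_n -> W) :
  linear L -> continuous L.
Proof.
move=> lL.
pose LL : {linear 'rV[R]_n -> W} := HB.pack L (GRing.isLinear.Build _ _ _ _ L lL).
apply: (lipschitz_linear_continuous (K := \sum_j `|L (delta_mx 0 j)|) lL) => [|h].
  exact: sumr_ge0.
have {1}-> : L h = \sum_j h 0 j *: L (delta_mx 0 j).
  rewrite {1}(row_sum_delta h) -[L]/(LL : _ -> _) linear_sum.
  by apply: eq_bigr => j _; rewrite linearZ.
rewrite (le_trans (ler_norm_sum _ _ _))// mulr_suml; apply: ler_sum => j _.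
by rewrite normrZ mulrC ler_wpM2l// rv_norm_coord.
Qed.

(** For maps on a product space, such as the pairs (x, sigma), which are not row vectors. The
    differential of [L] being constant, the direction [L v] does not move with the point. *)
Lemma class_C_comp_linear (V V' : normedModType R) (W : normedModType R) r
    (U : set V) (f : V -> W) (L : V' -> V) :
  linear L -> continuous L -> open U -> class_C r U f ->
  class_C r (L @^-1` U) (fun x => f (L x)).
Proof.
move=> lL cL oU.
have oLU : open (L @^-1` U) by apply: open_comp => // x _; exact: cL.
pose LL : {linear V' -> V} := HB.pack L (GRing.isLinear.Build _ _ _ _ L lL).
have dL x : differentiable L x by exact: (@linear_differentiable _ _ _ LL).
have eL x : 'd L x = L :> (_ -> _) by exact: (@diff_lin _ _ _ LL).
elim: r f => [|r IH] f.
  move=> Hf x Ux; apply: continuous_comp; first exact: cL.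
  exact: (Hf _ Ux).
move=> [f1 f2]; split=> [x Ux|v].
  exact: differentiable_comp (dL x) (f1 _ Ux).
apply: class_C_ext (IH _ (f2 (L v))) => // x Ux.
have /= -> := congr1 (fun h => h v) (diff_comp (dL x) (f1 _ Ux)).
by rewrite eL.
Qed.
End LinearMaps.

(** * The variables of T_k as one row vector, and the rank of its differential *)

Section Params.
Variables (R : realType) (n1 n2 k : nat).

Definition params_of_row (z : 'rV[R]_(k + k * n1 + k * n2)) : params R n1 n2 k :=
  (lsubmx (lsubmx z), vec_mx (rsubmx (lsubmx z)), vec_mx (rsubmx z)).

Definition row_of_params (p : params R n1 n2 k) : 'rV[R]_(k + k * n1 + k * n2) :=
  row_mx (row_mx p.1.1 (mxvec p.1.2)) (mxvec p.2).

Lemma row_of_paramsK : cancel row_of_params params_of_row.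
Proof.
by move=> [[c x] s]; rewrite /params_of_row /row_of_params !(row_mxKl, row_mxKr) !mxvecK.
Qed.

Lemma params_of_rowK : cancel params_of_row row_of_params.
Proof.
by move=> z; rewrite /params_of_row /row_of_params /= !vec_mxK !hsubmxK.
Qed.

Lemma params_of_row_linear : linear params_of_row.
Proof.
move=> a u v; rewrite /params_of_row !linearP /=.
by [].
Qed.

Lemma row_of_params_linear : linear row_of_params.
Proof.
move=> a u v; rewrite /row_of_params /= !linearP /=.
by rewrite !scale_row_mx !add_row_mx.
Qed.

Lemma params_of_row_continuous : continuous params_of_row.
Proof. exact/rV_linear_continuous/params_of_row_linear. Qed.

Lemma continuous_fst_fst (V1 V2 V3 : normedModType R) :
  continuous (fun p : V1 * V2 * V3 => p.1.1).
Proof.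
move=> p; apply: (@continuous_comp _ _ _ (fun p : V1 * V2 * V3 => p.1) (fun p : V1 * V2 => p.1)).
  exact: cvg_fst.
exact: cvg_fst.
Qed.

Lemma continuous_fst_snd (V1 V2 V3 : normedModType R) :
  continuous (fun p : V1 * V2 * V3 => p.1.2).
Proof.
move=> p; apply: (@continuous_comp _ _ _ (fun p : V1 * V2 * V3 => p.1) (fun p : V1 * V2 => p.2)).
  exact: cvg_fst.
exact: cvg_snd.
Qed.

Lemma row_of_params_continuous : continuous row_of_params.
Proof.
move=> p; apply: continuous_row => j.
have comp (M N : nat) (g : params R n1 n2 k -> 'M[R]_(M, N)) (i : 'I_M) (l : 'I_N) :
    continuous g -> {for p, continuous (fun q => g q i l : R^o)}.
  move=> cg; apply: (@continuous_comp _ _ _ g (fun A : 'M[R]_(M, N) => A i l : R^o)).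
    exact: cg.
  exact: coord_continuous.
rewrite /row_of_params; have [j1 ->|j1 ->] := split_ordP j.
  have [j2 ->|j2 ->] := split_ordP j1.
    rewrite (_ : (fun u => _) = (fun q : params R n1 n2 k => q.1.1 0 j2 : R^o)).
      by apply: comp; exact: continuous_fst_fst.
    by apply/funext => q; rewrite !row_mxEl.
  have [i l] := mxvec_indexP j2.
  rewrite (_ : (fun u => _) = (fun q : params R n1 n2 k => q.1.2 i l : R^o)).
    by apply: comp; exact: continuous_fst_snd.
  by apply/funext => q; rewrite row_mxEl row_mxEr mxvecE.
have [i l] := mxvec_indexP j1.
rewrite (_ : (fun u => _) = (fun q : params R n1 n2 k => q.2 i l : R^o)).
  by apply: comp => q; exact: cvg_snd.
by apply/funext => q; rewrite row_mxEr mxvecE.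
Qed.

Lemma dim_params : \dim {:params R n1 n2 k} = (k * (n1 + n2 + 1))%N.
Proof.
rewrite dimvf; change (1 * k + k * n1 + k * n2 = k * (n1 + n2 + 1))%N.
by rewrite !mulnDr muln1 mul1n -addnA addnC.
Qed.

Lemma DT_full_rank_dim m X S (t : 'rV[R]_n1 -> 'rV[R]_n2 -> 'rV[R]_m) :
  DT_full_rank X S t k -> (m <= k * (n1 + n2 + 1))%N.
Proof.
move=> [p [_ _ <-]]; rewrite -dim_params.
by rewrite -(limg_ker_dim (linfun ('d (T_map t (k := k)) p)) fullv) leq_addl.
Qed.

(** The rows of [M] are the images of the basis vectors, so the differential is right multiplication
    by [M]. If its rank is below [m], a nonzero column of the cokernel matrix is the covector. *)
Lemma not_DT_full_rank m X S (t : 'rV[R]_n1 -> 'rV[R]_n2 -> 'rV[R]_m) p :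
  T_dom X S p -> differentiable (T_map t (k := k)) p -> ~ DT_full_rank X S t k ->
  exists2 lam : 'I_m -> R, exists i, lam i != 0 &
    forall v, \sum_i lam i * 'd (T_map t (k := k)) p (params_of_row v) 0 i = 0.
Proof.
move=> Tp dT nfull; set D := 'd _ p in nfull *.
pose M : 'M[R]_(_, m) := \matrix_j D (params_of_row (delta_mx 0 j)).
have DM v : D (params_of_row v) = v *m M.
  have lin a u w : params_of_row (a *: u + w) = a *: params_of_row u + params_of_row w.
    exact: params_of_row_linear.
  pose PL : {linear _ -> params R n1 n2 k} :=
    HB.pack params_of_row (GRing.isLinear.Build _ _ _ _ _ params_of_row_linear).
  rewrite {1}(row_sum_delta v) -[params_of_row]/(PL : _ -> _) !linear_sum mulmx_sum_row.
  by apply: eq_bigr => j _; rewrite !linearZ /= rowK.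
have rM : (\rank M < m)%N.
  rewrite ltn_neqAle rank_leq_col andbT; apply/negP => fullM; apply: nfull.
  exists p; split=> //; rewrite -/D.
  suff -> : limg (linfun D) = fullv by rewrite dimvf; change (1 * m = m)%N; rewrite mul1n.
  apply/eqP; rewrite eqEsubv subvf /=; apply/subvP => w _.
  have /submxP[u ->] : (w <= M)%MS by apply: submx_full.
  by rewrite -DM -(lfunE D) memv_img ?memvf.
have /matrix0Pn[i [j cij]] : cokermx M != 0.
  by rewrite -mxrank_eq0 mxrank_coker subn_eq0 -ltnNge.
exists (fun i => cokermx M i j); first by exists i.
move=> v; rewrite -/D.
have E : (v *m M *m cokermx M) 0 j = 0 by rewrite -mulmxA mulmx_coker mulmx0 mxE.
rewrite -[RHS]E -DM mxE.
by apply: eq_bigr => l _; rewrite mulrC.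
Qed.
End Params.

Section PositiveParams.
Variables (R : realType) (n1 n2 m : nat) (X : set 'rV[R]_n1) (S : set 'rV[R]_n2).
Variable t : 'rV[R]_n1 -> 'rV[R]_n2 -> 'rV[R]_m.
Hypotheses (oX : open X) (oS : open S).

Let coord i (z : 'rV[R]_n1 * 'rV[R]_n2) : R^o := t z.1 z.2 0 i.

Lemma open_XS : open (X `*` S).
Proof.
rewrite openE => -[x s] [/= Xx Ss]; exists (X, S) => //=.
by split; exact: open_nbhs_nbhs.
Qed.

Definition atom k (l : 'I_k) (z : 'rV[R]_(k + k * n1 + k * n2)) :
    'rV[R]_n1 * 'rV[R]_n2 :=
  (row l (params_of_row z).1.2, row l (params_of_row z).2).

Lemma atom_linear k (l : 'I_k) : linear (atom l).
Proof.
move=> a u v; rewrite /atom params_of_row_linear /=.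
by rewrite !linearP.
Qed.

Lemma weight_linear k (l : 'I_k) :
  linear (fun z => (params_of_row z : params R n1 n2 k).1.1 0 l : R^o).
Proof. by move=> a u v; rewrite params_of_row_linear /= !mxE. Qed.

(** Strict positivity of the weights makes the domain open, which [T_dom] need not be and the C^r
    calculus requires. *)
Definition pos_dom k : set 'rV[R]_(k + k * n1 + k * n2) := [set z | forall l,
  0 < (params_of_row z).1.1 0 l /\ (X `*` S) (atom l z)].

Lemma open_pos_dom k : open (@pos_dom k).
Proof.
rewrite openE => z Uz.
suff : \forall w \near z, forall l : 'I_k,
    0 < (params_of_row w : params R n1 n2 k).1.1 0 l /\ (X `*` S) (atom l w) by [].
apply: near_forall => l; have [cz az] := Uz l.
have N1 : \forall w \near z, 0 < (params_of_row w : params R n1 n2 k).1.1 0 l.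
  have : open ((fun z => (params_of_row z : params R n1 n2 k).1.1 0 l : R^o) @^-1` [set r | 0 < r]).
    apply: open_comp; last exact: open_gt.
    by move=> x _; exact: (rV_linear_continuous (weight_linear l)).
  by rewrite openE; exact.
have N2 : \forall w \near z, (X `*` S) (atom l w).
  have : open (atom l @^-1` (X `*` S)).
    apply: open_comp; last exact: open_XS.
    by move=> x _; exact: (rV_linear_continuous (@atom_linear k l)).
  by rewrite openE; exact.
by near=> w; split; near: w.
Unshelve. all: by end_near. Qed.

Lemma pos_dom_T_dom k z : @pos_dom k z -> T_dom X S (params_of_row z : params R n1 n2 k).
Proof. by move=> Uz l; have [/ltW c0 [Xx Ss]] := Uz l. Qed.

Definition T_coord k i (z : 'rV[R]_(k + k * n1 + k * n2)) : R :=
  T_map t (params_of_row z) 0 i.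

Lemma T_coordE k i (z : 'rV[R]_(k + k * n1 + k * n2)) : T_coord i z =
  \sum_(l < k) (params_of_row z).1.1 0 l * coord i (atom l z).
Proof. by rewrite /T_coord /T_map summxE; apply: eq_bigr => l _; rewrite mxE. Qed.

Variable r : nat.
Hypothesis Ht : forall i, class_C r (X `*` S) (coord i).

Lemma class_C_T_coord k i : class_C r (@pos_dom k) (@T_coord k i : _ -> R^o).
Proof.
have oU := @open_pos_dom k.
apply: (class_C_ext (f := fun z => \sum_(l < k)
  ((params_of_row z).1.1 0 l * coord i (atom l z) : R^o))) => //.
  by move=> z _; rewrite T_coordE.
apply: class_C_sum => // l _; apply: class_C_mul => //.
  pose w (z : 'rV[R]_(k + k * n1 + k * n2)) : R^o := (params_of_row z : params R n1 n2 k).1.1 0 l.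
  have lw : linear w by exact: weight_linear.
  pose wL : {linear _ -> R^o} := HB.pack w (GRing.isLinear.Build _ _ _ _ w lw).
  have cw : continuous wL by exact: rV_linear_continuous lw.
  exact: (class_C_lin r _ cw).
have ca : continuous (@atom k l) by exact/rV_linear_continuous/atom_linear.
have H := class_C_comp_linear (@atom_linear k l) ca open_XS (Ht i).
by apply: class_C_sub H => z /(_ l)[].
Qed.

Lemma differentiable_T_map k z : (0 < r)%N -> pos_dom z ->
  differentiable (T_map t (k := k)) (params_of_row z) /\
  forall i v, dd (@T_coord k i) z v = 'd (T_map t (k := k)) (params_of_row z) (params_of_row v) 0 i.
Proof.
move=> r0 Uz.
pose Psi (w : 'rV[R]_(k + k * n1 + k * n2)) := T_map t (params_of_row w : params R n1 n2 k).
have dPsi w : pos_dom w -> differentiable Psi w.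
  move=> Uw; apply: diff_row => i; move: (@class_C_T_coord k i).
  by move: r0; case: (r) => // r' _ [/(_ _ Uw)].
pose RL : {linear params R n1 n2 k -> 'rV[R]_(k + k * n1 + k * n2)} :=
  HB.pack (@row_of_params R n1 n2 k)
    (GRing.isLinear.Build _ _ _ _ _ (@row_of_params_linear R n1 n2 k)).
have dR p : differentiable (@row_of_params R n1 n2 k) p.
  by apply: (@linear_differentiable _ _ _ RL); exact: row_of_params_continuous.
pose PL : {linear 'rV[R]_(k + k * n1 + k * n2) -> params R n1 n2 k} :=
  HB.pack (@params_of_row R n1 n2 k)
    (GRing.isLinear.Build _ _ _ _ _ (@params_of_row_linear R n1 n2 k)).
have dP w : differentiable (@params_of_row R n1 n2 k) w.
  by apply: (@linear_differentiable _ _ _ PL); exact: params_of_row_continuous.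
have eP w : 'd (@params_of_row R n1 n2 k) w = @params_of_row R n1 n2 k :> (_ -> _).
  by apply: (@diff_lin _ _ _ PL); exact: params_of_row_continuous.
have dT : differentiable (T_map t (k := k)) (params_of_row z).
  rewrite (_ : T_map t (k := k) = Psi \o @row_of_params R n1 n2 k); last first.
    by apply/funext => p; rewrite /Psi /= row_of_paramsK.
  apply: differentiable_comp (dR _) _; apply: dPsi.
  by rewrite params_of_rowK.
split=> // i v.
have [_ Ei] := diff_coord i (dPsi _ Uz).
rewrite ddE (_ : 'd _ z = 'd (fun u => Psi u 0 i : R^o) z) // Ei.
by have /= -> := congr1 (fun h => h v) (diff_comp (dP z) dT); rewrite eP.
Qed.

(** The source has dimension [k * (n1 + n2 + 1)], and Sard's theorem, stated for class C^(r+1), is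
    used with [r.-1]; hence the strict inequality. *)
Lemma thin_T_coord k K : (k * (n1 + n2 + 1) + 1 < r + m)%N -> (0 < r)%N ->
  ~ DT_full_rank X S t k -> compact K -> K `<=` @pos_dom k ->
  ~ fat finset.setT (@T_coord k) K.
Proof.
move=> kr r0 nfull cK KU.
apply: (@sard_thin R m _ r.-1 (@pos_dom k)) => //.
- exact: open_pos_dom.
- by move=> i; rewrite prednK//; exact: class_C_T_coord.
- rewrite cardsT card_ord; lia.
move=> z /KU Uz; have [dT E] := differentiable_T_map r0 Uz.
have [lam [i li] H] := not_DT_full_rank (pos_dom_T_dom Uz) dT nfull.
exists lam; first by exists i => //; rewrite inE.
move=> v; rewrite -[RHS](H v); apply: eq_big => [j|j _]; first by rewrite inE.
by rewrite E.
Qed.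
End PositiveParams.

(** * Independent atoms, full rank at zero weights, and positive representations *)

Section FullRank.
Variables (R : realType) (n1 n2 m : nat) (X : set 'rV[R]_n1) (S : set 'rV[R]_n2).
Variable t : 'rV[R]_n1 -> 'rV[R]_n2 -> 'rV[R]_m.
Hypothesis t_indep : forall lam : 'I_m -> R,
  (forall x s, X x -> S s -> \sum_i lam i * t x s 0 i = 0) -> forall i, lam i = 0.

(** Greedy choice: fewer than [m] vectors are killed by a nonzero covector, a column of [cokermx M].
    By independence this covector is nonzero at some atom, which therefore raises the rank. *)
Lemma independent_atoms : exists z : 'I_m -> 'rV[R]_n1 * 'rV[R]_n2,
  (forall i, (X `*` S) (z i)) /\ \matrix_i t (z i).1 (z i).2 \in unitmx.
Proof.
suff H k : (k <= m)%N -> exists z : 'I_k -> 'rV[R]_n1 * 'rV[R]_n2,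
    (forall i, (X `*` S) (z i)) /\ \rank (\matrix_i t (z i).1 (z i).2) = k.
  have [z [zXS rz]] := H m (leqnn m); exists z; split=> //.
  by rewrite -row_free_unit /row_free rz.
elim: k => [_|k IH km].
  exists (fun=> 0); split; first by case.
  by apply/eqP; rewrite -leqn0 rank_leq_row.
have [z [zXS rz]] := IH (ltnW km); set M := \matrix_i _ in rz.
have /matrix0Pn[i [j cij]] : cokermx M != 0.
  by rewrite -mxrank_eq0 mxrank_coker subn_eq0 -ltnNge rz.
have [[x s] [Xx Ss tc]] : exists xs : 'rV[R]_n1 * 'rV[R]_n2,
    [/\ X xs.1, S xs.2 & \sum_i cokermx M i j * t xs.1 xs.2 0 i != 0].
  apply: contrapT => N; move/eqP: cij; apply.
  apply: (t_indep (lam := fun i => cokermx M i j)) => x s Xx Ss.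
  by apply/eqP/negPn/negP => ne; apply: N; exists (x, s).
have nsub : ~~ (t x s <= M)%MS.
  apply: contra tc; rewrite submxE => /eqP/matrixP/(_ 0 j).
  rewrite !mxE => E; rewrite -[X in _ == X]E; apply/eqP/eq_bigr => l _ /=.
  by rewrite mulrC.
pose z' (l : 'I_k.+1) := if unlift ord_max l is Some l' then z l' else (x, s).
exists z'; split.
  by move=> l; rewrite /z'; case: unliftP => [l' _|_]; [exact: zXS|split].
set M' := \matrix_l _.
have MM' : (M <= M')%MS.
  apply/row_subP => l; apply: (submx_trans _ (row_sub (lift ord_max l) M')).
  by rewrite !rowK /z' liftK.
have tM' : (t x s <= M')%MS.
  apply: (submx_trans _ (row_sub ord_max M')).
  by rewrite rowK /z' unlift_none.
have : (M < M')%MS.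
  by rewrite ltmxE MM' /=; apply: contra nsub => /(submx_trans tM').
move=> /rank_ltmx; rewrite rz => r1.
by apply/eqP; rewrite eqn_leq rank_leq_row r1.
Qed.

Hypothesis t_cont : forall i z, (X `*` S) z ->
  {for z, continuous (fun z : 'rV[R]_n1 * 'rV[R]_n2 => t z.1 z.2 0 i : R^o)}.

Lemma norm_weight_le k (h : params R n1 n2 k) i : `|h.1.1 0 i| <= `|h|.
Proof.
apply: le_trans (rv_norm_coord _ _) _.
apply: (@le_trans _ _ `|h.1|); first by rewrite [leRHS]prod_normE le_max lexx.
by rewrite [leRHS]prod_normE le_max lexx.
Qed.

(** All weights of [p] vanish, so the increment of T_k is the sum of the weights of [h] times the
    moved atoms. The weights are already O(|h|), and replacing moved atoms by those of [p] costs
    o(|h|) by continuity. *)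
Lemma diff_T_map_weight0 k (p : params R n1 n2 k) : p.1.1 = 0 ->
  (forall l, (X `*` S) (row l p.1.2, row l p.2)) ->
  differentiable (T_map t (k := k)) p /\
  'd (T_map t (k := k)) p =
    (fun h => \sum_l h.1.1 0 l *: t (row l p.1.2) (row l p.2)) :> (_ -> _).
Proof.
move=> p0 pXS.
pose tau l (q : params R n1 n2 k) := t (row l q.1.2) (row l q.2).
pose D (h : params R n1 n2 k) : 'rV[R]_m := \sum_l h.1.1 0 l *: tau l p.
have lD : linear D.
  move=> a u v; rewrite /D scaler_sumr -big_split /=; apply: eq_bigr => l _.
  by rewrite !mxE scalerDl scalerA.
have cD : continuous D.
  apply: (lipschitz_linear_continuous (K := \sum_l `|tau l p|) lD) => [|h].
    exact: sumr_ge0.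
  rewrite (le_trans (ler_norm_sum _ _ _))// mulr_suml; apply: ler_sum => l _.
  by rewrite normrZ mulrC ler_wpM2l// norm_weight_le.
have atomE l q : atom l (row_of_params q) = (row l q.1.2, row l q.2).
  by rewrite /atom row_of_paramsK.
have ctau l : {for p, continuous (tau l)}.
  rewrite (_ : tau l = (fun z => t z.1 z.2) \o (atom l \o @row_of_params R n1 n2 k)); last first.
    by apply/funext => q; rewrite /comp atomE.
  apply: continuous_comp.
    apply: continuous_comp; first exact: row_of_params_continuous.
    exact/rV_linear_continuous/atom_linear.
  apply: continuous_row => i; apply: t_cont.
  by rewrite /comp atomE; exact: pXS.
pose DL : {linear params R n1 n2 k -> 'rV[R]_m} :=
  HB.pack D (GRing.isLinear.Build _ _ _ _ D lD).
apply: (@diff_of_eps _ _ _ _ DL) => [|e e0]; first exact: cD.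
(* [k.+1] rather than [k] avoids a division by zero when there is no atom. *)
have e1 : 0 < e / k.+1%:R by rewrite divr_gt0.
have N : \forall q \near p, forall l, `|tau l p - tau l q| <= e / k.+1%:R.
  by apply: near_forall => l; have /cvgrPdist_le := ctau l; apply.
move: N; rewrite (near_shift 0) /=; apply: filterS => h; rewrite subr0 => Hh.
have T0 : T_map t p = 0.
  by rewrite /T_map big1// => l _; rewrite p0 mxE scale0r.
have -> : T_map t (h + p) - T_map t p - DL h =
    \sum_l h.1.1 0 l *: (tau l (h + p) - tau l p).
  rewrite T0 subr0; change (DL h) with (D h); rewrite /D /T_map -sumrB.
  have -> : (h + p).1.1 = h.1.1 by rewrite [LHS]/= p0 addr0.
  by apply: eq_bigr => l _; rewrite scalerBr.
rewrite (le_trans (ler_norm_sum _ _ _))//.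
apply: (@le_trans _ _ (\sum_(l < k) `|h| * (e / k.+1%:R))).
  apply: ler_sum => l _; rewrite normrZ ler_pM ?norm_weight_le//.
  by rewrite distrC.
rewrite sumr_const card_ord -mulrnAr mulrC ler_wpM2r// -mulr_natr -mulrA.
by rewrite ler_piMr ?(ltW e0)// mulrC ler_pdivrMr// mul1r ler_nat leqnSn.
Qed.

Lemma DT_full_rank_m : DT_full_rank X S t m.
Proof.
have [z [zXS Pu]] := independent_atoms; set P := \matrix_i _ in Pu.
pose p : params R n1 n2 m := (0, \matrix_i (z i).1, \matrix_i (z i).2).
have rp i : (row i p.1.2, row i p.2) = z i by rewrite !rowK -surjective_pairing.
have pXS l : (X `*` S) (row l p.1.2, row l p.2) by rewrite rp.
have [dT ET] := @diff_T_map_weight0 m p erefl pXS.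
exists p; split => //.
  by move=> i; have [] := pXS i; split=> //; rewrite mxE.
suff -> : limg (linfun ('d (T_map t (k := m)) p)) = fullv.
  by rewrite dimvf; change (1 * m = m)%N; rewrite mul1n.
apply/eqP; rewrite eqEsubv subvf /=; apply/subvP => w _.
have -> : w = linfun ('d (T_map t (k := m)) p) ((w *m invmx P, 0, 0) : params R n1 n2 m).
  rewrite lfunE /= ET -[LHS](mulmxKV Pu) mulmx_sum_row; apply: eq_bigr => i _.
  by rewrite !rowK.
by rewrite memv_img ?memvf.
Qed.

Definition cone_rep (s : 'rV[R]_m) : set nat := [set k |
  exists (c : 'I_k -> R) (x : 'I_k -> 'rV[R]_n1)
                          (sigma : 'I_k -> 'rV[R]_n2),
    (forall i, [/\ 0 < c i, X (x i) & S (sigma i)]) /\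
    s = \sum_(i < k) c i *: t (x i) (sigma i)].

(** Atoms of weight 0 are discarded; the number [k] of the others may be 0, in which case the sum is
    empty. *)
Lemma moment_cone_positive s : moment_cone X S t s ->
  exists2 k, (k <= m)%N & cone_rep s k.
Proof.
move=> [p Tp <-].
pose A := [set i | 0 < p.1.1 0 i]%SET.
exists #|A|; first by rewrite -[leqRHS]card_ord max_card.
exists (fun i => p.1.1 0 (enum_val i)), (fun i => row (enum_val i) p.1.2),
  (fun i => row (enum_val i) p.2); split.
  move=> i; have [_ Xx Ss] := Tp (enum_val i); split=> //.
  by have := enum_valP i; rewrite inE.
rewrite /T_map (bigID (fun i => i \in A)) /= [X in _ + X]big1 ?addr0.
  by rewrite big_enum_val.
move=> i; rewrite inE -leNgt => ci; have [ci0 _ _] := Tp i.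
by rewrite (@le_anti _ _ (p.1.1 0 i) 0) ?ci// scale0r.
Qed.

(** The values of [C_M_at] on the cone are bounded by [m], so that the maximum is attained and
    [nat_max] does not fall back on its default. *)
Lemma moment_cone_C_M s : moment_cone X S t s ->
  exists2 k, (k <= C_M X S t)%N & cone_rep s k.
Proof.
move=> cs; exists (C_M_at X S t s).
  apply: (@nat_max_ge _ m); last by exists s.
  move=> _ [s' /moment_cone_positive[k km Hk] <-].
  by apply: leq_trans km; exact: (@nat_minP (cone_rep s') k Hk).2.
have [k km Hk] := moment_cone_positive cs.
exact: (@nat_minP (cone_rep s) k Hk).1.
Qed.

End FullRank.

Lemma open_compact_exhaustion (R : realType) n (U : set 'rV[R]_n) : open U ->
  exists K : nat -> set 'rV[R]_n,
    (forall i, compact (K i) /\ K i `<=` U) /\ U `<=` \bigcup_i K i.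
Proof.
(* Points of norm at most [i] and at distance at least 1/(i+1) from the complement of [U]. *)
move=> oU; pose K i : set 'rV[R]_n := cball 0 i%:R `&`
  \bigcap_(v in ~` U) ~` nball v i.+1%:R^-1.
exists K; split.
  move=> i; split.
    apply: bounded_closed_compact.
      exists i%:R; split; first by rewrite realn.
      by move=> M iM x [+ _]; rewrite /cball /= subr0 => /le_trans; apply; exact: ltW.
    apply: closedI; first exact: closed_cball.
    by apply: closed_bigI => v _; apply: open_closedC; exact: open_nball.
  move=> x [_ Kx]; apply: contrapT => nUx; apply: (Kx x nUx).
  by rewrite /nball /= subrr normr0 invr_gt0.
move=> x Ux; have /nbhs_ballP[e e0 He] : nbhs x U by exact: open_nbhs_nbhs.
have [p] := ltr_add_invr e0; rewrite add0r => pe.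
pose i := maxn p (Num.truncn `|x|).+1.
exists i => //; split.
  have /andP[_ xi] := truncn_itv (normr_ge0 x).
  rewrite /cball /= subr0 (le_trans (ltW xi))// ler_nat leq_maxr//.
move=> v nUv; rewrite /nball /= => xv; apply: nUv; apply: He.
rewrite -ball_normE /=; apply: lt_trans xv _; apply: le_lt_trans pe.
by rewrite lef_pV2 ?posrE// ler_nat ltnS leq_maxl.
Qed.

Section Main.
Variables (R : realType) (n1 n2 m r : nat) (X : set 'rV[R]_n1) (S : set 'rV[R]_n2).
Variable t : 'rV[R]_n1 -> 'rV[R]_n2 -> 'rV[R]_m.
Hypotheses (oX : open X) (oS : open S).
Hypothesis t_indep : forall lam : 'I_m -> R,
  (forall x s, X x -> S s -> \sum_i lam i * t x s 0 i = 0) -> forall i, lam i = 0.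
Hypothesis Ht : forall i, class_C r (X `*` S) (fun z => t z.1 z.2 0 i : R^o).

(** Full rank at [k = m] makes the set nonempty, which excludes the default value of [nat_min]. *)
Lemma N_M_spec : DT_full_rank X S t (N_M X S t) /\
  forall k, DT_full_rank X S t k -> (N_M X S t <= k)%N.
Proof.
apply: (@nat_minP [set k | DT_full_rank X S t k] m).
by apply: DT_full_rank_m => // i z; exact: class_C_continuous (Ht i).
Qed.

Lemma dim_le_N_M : (m <= N_M X S t * (n1 + n2 + 1))%N.
Proof. exact: DT_full_rank_dim N_M_spec.1. Qed.

(** [y0] is the sum of [m] independent atoms. Its coordinates in this basis are all 1, and they stay
    positive nearby. *)
Lemma moment_cone_interior : exists (y0 : 'rV[R]_m) e, 0 < e /\
  nball y0 e `<=` moment_cone X S t.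
Proof.
have [z [zXS Pu]] := independent_atoms t_indep; set P := \matrix_i _ in Pu.
pose y0 : 'rV[R]_m := const_mx 1 *m P.
have : \forall y \near y0, forall i, 0 < (y *m invmx P) 0 i.
  apply: near_forall => i; pose g (y : 'rV[R]_m) : R^o := (y *m invmx P) 0 i.
  have lg : linear g by move=> a u v; rewrite /g mulmxDl -scalemxAl !mxE.
  have g0 : 0 < g y0 by rewrite /g mulmxK// mxE.
  have cg : {for y0, continuous g} by exact: rV_linear_continuous lg y0.
  have [d d0 Hd] := continuous_pos cg g0.
  apply/nbhs_ballP; exists d => // y; rewrite -ball_normE /= distrC.
  exact: Hd.
move=> /nbhs_ballP[e e0 He]; exists y0, e; split=> // y ye.
have {}He : forall i, 0 < (y *m invmx P) 0 i.
  by apply: He; rewrite -ball_normE /= distrC.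
exists (y *m invmx P, \matrix_i (z i).1, \matrix_i (z i).2).
  by move=> i; have [Xz Sz] := zXS i; split; rewrite ?rowK//; exact: ltW.
apply: etrans (mulmxKV Pu y); rewrite [RHS]mulmx_sum_row /T_map.
by apply: eq_bigr => i _; rewrite !rowK.
Qed.

Lemma N_M_le_C_M : (N_M X S t * (n1 + n2 + 1) < r + m)%N -> (N_M X S t <= C_M X S t)%N.
Proof.
move=> Nr; rewrite leqNgt; apply/negP => CN.
have r0 : (0 < r)%N.
  by have := leq_ltn_trans dim_le_N_M Nr; rewrite -{1}[m]add0n ltn_add2r.
have [y0 [e [e0 cone]]] := moment_cone_interior.
pose Psi k (w : 'rV[R]_(k + k * n1 + k * n2)) := T_map t (params_of_row w).
have ex k := cid (open_compact_exhaustion (@open_pos_dom R n1 n2 X S oX oS k)).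
pose K k := projT1 (ex k).
have HK k : (forall i, compact (K k i) /\ K k i `<=` @pos_dom R n1 n2 X S k) /\
  @pos_dom R n1 n2 X S k `<=` \bigcup_i K k i := projT2 (ex k).
pose As (j : nat * nat) := if (j.1 <= C_M X S t)%N then Psi j.1 @` K j.1 j.2 else set0.
have cPsi k j : compact (Psi k @` K k j).
  apply: compact_image; last exact: ((HK k).1 j).1.
  move=> w /((HK k).1 j).2 Uw; apply: continuous_row => i.
  have H := class_C_continuous (@class_C_T_coord R n1 n2 m X S t oX oS r Ht k i) Uw.
  exact: H.
have cB : compact (cball y0 e).
  apply: bounded_closed_compact; last exact: closed_cball.
  exists (`|y0| + e); split; first exact: num_real.
  move=> M HM x; rewrite /cball /= => xe; apply: le_trans (ltW HM).
  by rewrite -(subrK y0 x) (le_trans (ler_normD _ _))// addrC lerD2l.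
(* Baire's theorem in the target R^m itself, with the coordinates as functions: one compact image of
   some T_k, with [k] at most [C_M], has nonempty interior. *)
have [||||[k j]] := @fat_baire R m m finset.setT (fun i y => y 0 i) (cball y0 e)
    (nball y0 e) _ As cB.
- by move=> i x _; exact: coord_continuous.
- by move=> [k j]; rewrite /As; case: ifP => // _; exact: compact0.
- move=> y /cone /moment_cone_C_M[k kC [c [x [s [pos ->]]]]].
  pose w := row_of_params ((\row_l c l, \matrix_l x l, \matrix_l s l) : params R n1 n2 k).
  have Uw : pos_dom X S w.
    by move=> l; rewrite /atom row_of_paramsK /= mxE !rowK; have [] := pos l.
  have [j _ Kw] := (HK k).2 _ Uw; exists (k, j) => //; rewrite /As kC; exists w => //.
  rewrite /Psi /w row_of_paramsK /T_map /=; apply: eq_bigr => l _.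
  by rewrite mxE !rowK.
- exists y0, e; split=> // y ye; exists y => //; split=> //; exact: ltW.
rewrite /As; case: ifP => kC; last first.
  move=> [y [d [d0 /(_ y)[]]]]; first by rewrite /nball /= subrr normr0.
  by move=> x [].
move=> fA; have {}fA : fat finset.setT (fun i y => y 0 i) (Psi k @` K k j).
  by apply: fatS fA => x [].
have kN : (k < N_M X S t)%N by exact: leq_ltn_trans kC CN.
(* With d = n1 + n2 + 1 >= 1 and k < [N_M], k d + 1 <= (k + 1) d <= [N_M] d: this is the slack for
   the extra derivative. *)
apply: (thin_T_coord oX oS Ht _ r0 _ ((HK k).1 j).1 ((HK k).1 j).2 (fat_image fA)).
  apply: leq_ltn_trans Nr.
  apply: (@leq_trans (k.+1 * (n1 + n2 + 1))); last by rewrite leq_mul2r kN orbT.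
  by rewrite mulSn addnC leq_add2r addn1.
by move=> /N_M_spec.2; rewrite leqNgt kN.
Qed.
End Main.

Theorem theorem29 (R : realType) (n1 n2 m r : nat)
    (X : set 'rV[R]_n1) (Sigma : set 'rV[R]_n2)
    (delta : 'rV[R]_n1 -> 'rV[R]_n2 -> probability (borel_rV R n1) R)
    (a : 'I_m -> 'rV[R]_n1 -> R) (sigma0 : 'rV[R]_n2)
    (X_open : open X) (Sigma_open : open Sigma)
    (delta_on_X : forall x s, X x -> Sigma s -> delta x s X = 1%E)
    (a_cont : forall i, {within X, continuous (a i)})
    (a_indep : lin_indep_on X a)
    (a_integrable : forall i x s, X x -> Sigma s ->
       (delta x s).-integrable X (EFin \o a i))
    (sigma0_closure : closure Sigma sigma0)
    (a_limit : forall i x, X x ->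
       moment X a delta i x s @[s --> within Sigma (nbhs sigma0)] --> a i x)
    (b_class_C : forall i,
       class_C r (X `*` Sigma) (fun z => moment X a delta i z.1 z.2 : R^o))
    (r_large :
       (N_M X Sigma (moment_vec X a delta) * (n1 + n2 + 1))%:Z - m%:Z < r%:Z) :
  Num.ceil (m%:R / (n1 + n2 + 1)%:R : R)
    <= (N_M X Sigma (moment_vec X a delta))%:Z /\
  (N_M X Sigma (moment_vec X a delta) <= C_M X Sigma (moment_vec X a delta))%N.
Proof.

(* A linear relation among the moments for all parameters passes to the limit at [sigma0], where it
   becomes a relation among the [a i]. *)
have t_indep (lam : 'I_m -> R) :
    (forall x s, X x -> Sigma s ->
      \sum_i lam i * moment_vec X a delta x s 0 i = 0) -> forall i, lam i = 0.
  move=> H; apply: a_indep => x Xx.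
  (* [sigma0] is in the closure of [Sigma], so the filter is proper and limits along it are
     unique. *)
  have PF : ProperFilter (within Sigma (nbhs sigma0)).
    exact: within_nbhs_proper.
  have cv : \sum_i lam i * moment X a delta i x s @[s --> within Sigma (nbhs sigma0)]
      --> \sum_i lam i * a i x.
    apply: cvg_big => [|i _]; first exact: add_continuous.
    by apply: cvgM; [exact: cvg_cst|exact: a_limit].
  have cv0 : \sum_i lam i * moment X a delta i x s @[s --> within Sigma (nbhs sigma0)]
      --> (0 : R).
    apply: cvg_near_cst.
    rewrite near_withinE; near=> s => Ss.
    rewrite -[RHS](H x s Xx Ss); apply: eq_bigr => i _.
    by rewrite mxE.
  exact: (cvg_unique _ cv cv0).
have Ht i : class_C r (X `*` Sigma) (fun z => moment_vec X a delta z.1 z.2 0 i : R^o).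
  rewrite (_ : (fun z => _) = (fun z => moment X a delta i z.1 z.2 : R^o)) //.
  by apply/funext => z; rewrite mxE.
set N := N_M _ _ _ in r_large *.
split.
  rewrite ceil_le_int ler_pdivrMr ?ltr0n ?addn1// -pmulrn -natrM ler_nat.
  by have := dim_le_N_M t_indep Ht; rewrite addn1.
apply: (N_M_le_C_M X_open Sigma_open t_indep Ht).
rewrite -/N; lia.
Unshelve. all: by end_near. Qed.
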